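(* Let $k\ge 1$ and let $f_1,\ldots,f_k:\mathbb{N}\to\mathbb{N}$ be polynomial functions with integer coefficients. For $n\in\mathbb{N}$ let $S_n=\langle f_1(n),\ldots,f_k(n)\rangle=\{\lambda_1 f_1(n)+\cdots+\lambda_k f_k(n):\lambda_i\in\mathbb{N}\}\subseteq\mathbb{N}$. \begin{enumerate} \item The following subsets of $\mathbb{N}$ are eventually periodic: (a) the set of $n$ for which $S_n$ is a numerical semigroup (i.e. $|\mathbb{N}\setminus S_n|<\infty$); (b) the set of $n$ for which $S_n$ is a symmetric numerical semigroup; (c) the set of $n$ for which $S_n$ is an irreducible numerical semigroup. \item Each of the following quantities, whenever finite (and defined), is eventually quasi-polynomial in $n$, i.e. there is an eventually quasi-polynomial function $g:\mathbb{N}\to\mathbb{Z}$ agreeing with the quantity at every $n$ at which it is finite: (a) the genus $\mathrm{g}(S_n)=|\mathbb{N}\setminus S_n|$; (b) the Frobenius number $\mathrm{F}(S_n)=\max(\mathbb{N}\setminus S_n)$; (c) the type of $S_n$; (d) the cardinality $|\mathrm{FG}(S_n)|$ of the set of fundamental gaps of $S_n$; (e) the cardinality of the delta set $\Delta(S_n)$; (f) for any fixed $i\ge 1$, the $i$-th smallest element of the Apéry set $\mathrm{Ap}(S_n)$. \item Let $a:\mathbb{N}\to\mathbb{N}$ be given by a polynomial function. Then the following functions of $n$ are eventually quasi-polynomial: (a) the cardinality of the length set $\mathrm{L}_{S_n}(a(n))$ (taken to be empty if $a(n)\notin S_n$); (b) the cardinality of the delta set $\Delta_{S_n}(a(n))$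 (taken to be empty if $|\mathrm{L}_{S_n}(a(n))|\le 1$). \end{enumerate}
   Context: $\mathbb{N}=\{0,1,2,\ldots\}$. A set $A\subseteq\mathbb{N}$ is eventually periodic if there are $N_0$ and $p\ge 1$ with $n\in A\iff n+p\in A$ for all $n\ge N_0$; a function $c:\mathbb{N}\to\mathbb{Q}$ is eventually periodic if $c(n+p)=c(n)$ for all $n\ge N_0$. A function $f:\mathbb{N}\to\mathbb{Z}$ is eventually quasi-polynomial (EQP) of degree $d$ if there are eventually periodic $c_0,\ldots,c_d:\mathbb{N}\to\mathbb{Q}$ with $f(n)=c_d(n)n^d+\cdots+c_0(n)$ for all $n$ and $c_d(n)\ne 0$ for infinitely many $n$. A numerical semigroup is a submonoid $S\subseteq\mathbb{N}$ (closed under addition, containing $0$) with $\mathbb{N}\setminus S$ finite. For such $S$: $\mathrm{F}(S)=\max(\mathbb{N}\setminus S)$. $S$ is symmetric if for all $z\in\mathbb{Z}$, $z\notin S$ implies $\mathrm{F}(S)-z\in S$. $S$ is irreducible if it is not the intersection of two numerical semigroups each strictly containing $S$. The set of pseudo-Frobenius numbers is $PF(S)=\{x\in\mathbb{Z}\setminus S: x+y\in S \text{ for all } y\in S\setminus\{0\}\}$, and the type of $S$ is $|PF(S)|$. A fundamental gap is an $x\in\mathbb{N}\setminus S$ with $jx\in S$ for every integer $j\ge 2$; $\mathrm{FG}(S)$ is the set of these. Writing $m(S)$ for the least positive element of $S$, the Apéry set is $\mathrm{Ap}(S)=\{y\in S: y-m(S)\notin S\}$ (it has $m(S)$ elements).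 For $S_n=\langle f_1(n),\ldots,f_k(n)\rangle$ and $a\in\mathbb{N}$, the length set is $\mathrm{L}_{S_n}(a)=\{z_1+\cdots+z_k: z_i\in\mathbb{N},\ a=\sum_i z_i f_i(n)\}$. If $\mathrm{L}_{S_n}(a)=\{\ell_1<\cdots<\ell_r\}$, then $\Delta_{S_n}(a)=\{\ell_{j+1}-\ell_j:1\le j<r\}$, and $\Delta(S_n)=\bigcup_{a\in S_n}\Delta_{S_n}(a)$.
   Formalization: Eventually zero functions are counted as eventually quasi-polynomial (for k=1, f_1=1 the genus is always 0, which has no degree), and in 3(a) agreement is required only at those n where the length set is finite (it can be infinite if some f_i(n)=0). *)

(* Defs.v *)
From mathcomp Require Import all_boot all_order all_algebra finmap.
From mathcomp Require Import boolp classical_sets functions cardinality.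

Set Implicit Arguments.
Unset Strict Implicit.
Unset Printing Implicit Defensive.

Import Order.TTheory GRing.Theory Num.Theory.

Local Open Scope classical_set_scope.
Local Open Scope ring_scope.

(** * Eventual periodicity and eventual quasi-polynomials *)

Definition eventually_periodic_set (A : set nat) : Prop :=
  exists N p : nat, (0 < p)%N /\
    forall n, (N <= n)%N -> (A n <-> A (n + p)%N).

Definition eventually_periodic_fun (c : nat -> rat) : Prop :=
  exists N p : nat, (0 < p)%N /\
    forall n, (N <= n)%N -> c (n + p)%N = c n.

Definition eqp_of_degree (d : nat) (f : nat -> int) : Prop :=
  exists c : 'I_d.+1 -> nat -> rat,
    [/\ forall j, eventually_periodic_fun (c j),
        forall n, (f n)%:~R = \sum_(j < d.+1) c j n * n%:R ^+ j
      & infinite_set [set n | c ord_max n != 0]].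

(* A function that vanishes from some point on has no degree in the above
   sense, because its leading coefficient would be eventually zero; like the
   zero polynomial, it still counts as quasi-polynomial. *)
Definition eqp (f : nat -> int) : Prop :=
  (exists d, eqp_of_degree d f) \/
  (exists N, forall n, (N <= n)%N -> f n = 0).

Definition polynomial_fun (R : nzRingType) (f : nat -> nat) : Prop :=
  exists P : {poly R}, forall n, (f n)%:R = P.[n%:R].

(* "n |-> #|A n| is eventually quasi-polynomial whenever finite" *)
Definition eqp_card (T : choiceType) (A : nat -> set T) : Prop :=
  exists2 g : nat -> int, eqp g &
    forall n, finite_set (A n) -> g n = (#|` fset_set (A n)|)%fset%:Z.

(* [Q n x] means that the partially defined quantity takes the value [x] at
   [n]. *)
Definition eqp_where_defined (Q : nat -> nat -> Prop) : Prop :=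
  exists2 g : nat -> int, eqp g & forall n x, Q n x -> g n = x%:Z.

(** * Numerical semigroups *)

Definition submonoid (S : set nat) : Prop :=
  S 0%N /\ forall x y, S x -> S y -> S (x + y)%N.

Definition numerical_semigroup (S : set nat) : Prop :=
  submonoid S /\ finite_set (~` S).

(* [S] seen as a set of integers. *)
Definition setZ (S : set nat) : set int := [set x%:Z | x in S].

Definition is_max (A : set nat) (x : nat) : Prop :=
  A x /\ forall y, A y -> (y <= x)%N.

Definition is_min (A : set nat) (x : nat) : Prop :=
  A x /\ forall y, A y -> (x <= y)%N.

(* The least element has rank 1. *)
Definition is_ith_smallest (i : nat) (A : set nat) (x : nat) : Prop :=
  [/\ (1 <= i)%N, A x & ([set y | A y /\ (y < x)%N] #= `I_i.-1)%card].

Definition is_frobenius (S : set nat) (F : nat) : Prop := is_max (~` S) F.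

(* [setT] has no Frobenius number here and so is symmetric, in agreement with
   the usual convention that its Frobenius number is -1. *)
Definition symmetric_semigroup (S : set nat) : Prop :=
  numerical_semigroup S /\
  forall F, is_frobenius S F ->
    forall z : int, ~ setZ S z -> setZ S (F%:Z - z).

Definition irreducible_semigroup (S : set nat) : Prop :=
  numerical_semigroup S /\
  ~ exists S1 S2 : set nat,
      [/\ numerical_semigroup S1, numerical_semigroup S2,
          S `<` S1, S `<` S2 & S = S1 `&` S2].

Definition pseudo_frobenius (S : set nat) : set int :=
  [set x | ~ setZ S x /\
           forall y : nat, S y -> y <> 0%N -> setZ S (x + y%:Z)].

Definition fundamental_gaps (S : set nat) : set nat :=
  [set x | ~ S x /\ forall j, (2 <= j)%N -> S (j * x)%N].

Definition is_multiplicity (S : set nat) (m : nat) : Prop :=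
  is_min [set x | S x /\ (0 < x)%N] m.

(* Empty when [S] has no positive element. *)
Definition apery (S : set nat) : set nat :=
  [set y | S y /\ exists2 m, is_multiplicity S m & ~ setZ S (y%:Z - m%:Z)].

(** * Factorization lengths *)

Definition generated (k : nat) (a : 'I_k -> nat) : set nat :=
  [set x | exists l : 'I_k -> nat, x = (\sum_(i < k) l i * a i)%N].

Definition length_set (k : nat) (a : 'I_k -> nat) (x : nat) : set nat :=
  [set l | exists z : 'I_k -> nat,
     x = (\sum_(i < k) z i * a i)%N /\ l = (\sum_(i < k) z i)%N].

(* Differences of consecutive elements; [L] may be infinite, which happens for
   a length set when some generator is 0. *)
Definition gaps_between (L : set nat) : set nat :=
  [set d | exists l l' : nat,
     [/\ L l, L l', (l < l')%N,
         forall y, L y -> ~ (l < y < l')%N & d = (l' - l)%N]].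

Definition delta_elt (k : nat) (a : 'I_k -> nat) (x : nat) : set nat :=
  gaps_between (length_set a x).

Definition delta_set (k : nat) (a : 'I_k -> nat) : set nat :=
  \bigcup_(x in generated a) delta_elt a x.

(* Main.v *)
Require Import Defs.
From mathcomp Require Import all_boot all_order all_algebra finmap.
From mathcomp Require Import boolp classical_sets functions cardinality.
From mathcomp Require Import zify ring lra.

Set Implicit Arguments.
Unset Strict Implicit.
Unset Printing Implicit Defensive.

Import Order.TTheory GRing.Theory Num.Theory.

Local Open Scope classical_set_scope.
Local Open Scope ring_scope.

(* A family [S_t] of subsets of [Z^k] is parametric Presburger if it is given by
   a first-order formula over [Z] whose atoms are linear inequalities with
   coefficients in [Z[t]].  By a parametric version of the Ferrante-Rackoff game
   argument, membership in [S_t] depends only on the residues of the variables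
   modulo [D(t)] and on finitely many linear forms truncated at [B(t)], with
   [D] and [B] polynomials; in particular all quantifiers can be bounded
   polynomially in [t].  Writing the bounded variables in base [t] then turns
   an inequality with coefficients in [Z[t]] into carries between digits, hence
   into a condition in ordinary Presburger arithmetic on [t] and the digits.
   So the truth of a closed formula is eventually periodic in [t], and the
   size of a finite definable [S_t] in [Z] is a number of lattice points of a
   Presburger set, computed by summing piecewise polynomials one digit at a
   time; both the truth and the size are read off for large [t] from the
   residue class of [t].  Every quantity of the theorem is definable: the type
   and the length and delta sets are definable by their very form,
   irreducibility means having at most one special gap, [jx] lies in [S] for
   all [j >= 2] as soon as [2x] and [3x] do, and a natural number is the size
   of the interval below it. *)

(** * Residues, truncated comparison and one round of the game *)

Definition congz (D u v : int) := exists q : int, u = v + q * D.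

(** For [B >= 0] this is equality after truncation: all values above [B] are identified, and so are
    all values below [- B]. *)
Definition near_eq (B u v : int) :=
  [\/ u = v, B < u /\ B < v | u < - B /\ v < - B].

Lemma near_eqW (B B' u v : int) : B <= B' -> near_eq B' u v -> near_eq B u v.
Proof.
move=> le [->|[h1 h2]|[h1 h2]]; [by constructor 1|constructor 2|constructor 3];
  split; lia.
Qed.

Lemma near_eq_shift (B s u v : int) :
  near_eq (B + `|s|) u v -> near_eq B (s + u) (s + v).
Proof.
case=> [->|[h1 h2]|[h1 h2]]; [by constructor 1|constructor 2|constructor 3];
  split; lia.
Qed.

Lemma near_eq_le0 (B u v : int) : 0 <= B -> near_eq B u v -> u <= 0 -> v <= 0.
Proof. by move=> B0 [->|[h1 h2]|[h1 h2]] //; lia. Qed.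

Lemma near_eq_sym (B u v : int) : near_eq B u v -> near_eq B v u.
Proof. by case=> [->|[? ?]|[? ?]]; [constructor 1|constructor 2|constructor 3]. Qed.

Lemma near_eqN (B u v : int) : near_eq B u v -> near_eq B (- u) (- v).
Proof.
case=> [->|[h1 h2]|[h1 h2]]; [by constructor 1|constructor 3|constructor 2];
  split; lia.
Qed.

(** Undoes the multiplication of a linear form by [d]: if [d * u] exceeds [B * |d|] in absolute
    value, then [u] exceeds [B]. *)
Lemma near_eq_scale (B C d u v : int) : d != 0 -> 0 <= B -> B * `|d| <= C ->
  near_eq C (d * u) (d * v) -> near_eq B u v.
Proof.
wlog d_gt0 : d u v / 0 < d => [th d0 B0 le nr|d0 B0 le].
  have [dp|dn] := ltP 0 d; first exact: (th d).
  by apply: (th (- d)); rewrite ?mulNr ?oppr_eq0 ?normrN ?oppr_gt0 //;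
     [rewrite lt_neqAle d0|apply: near_eqN].
rewrite gtr0_norm // in le.
have lep w : C < d * w -> B < w.
  by move=> Cw; rewrite -(ltr_pM2l d_gt0) mulrC; apply: le_lt_trans Cw.
case=> [/(mulfI d0)->|[h1 h2]|[h1 h2]]; first by constructor 1.
  by constructor 2; split; apply: lep.
by constructor 3; split; rewrite ltrNr; apply: lep; rewrite mulrN ltrNr.
Qed.

Lemma congz_sym D u v : congz D u v -> congz D v u.
Proof. by case=> q ->; exists (- q); ring. Qed.

Lemma congz_repr (D lo u : int) : 0 < D ->
  exists s, [/\ congz D s u, lo < s & s <= lo + D].
Proof.
move=> D0; exists (lo + 1 + ((u - lo - 1) %% D)%Z); split.
- exists (- ((u - lo - 1) %/ D)%Z).
  rewrite {2}(_ : u = (u - lo - 1) + lo + 1); last by ring.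
  by rewrite {2}(divz_eq (u - lo - 1) D); ring.
- have := modz_ge0 (u - lo - 1) (lt0r_neq0 D0); lia.
- have := ltz_pmod (u - lo - 1) D0; lia.
Qed.

(* One round of the Ehrenfeucht-Fraisse game: a point [X] is either close to
   some [p i], and is moved with it, or it is far from all of them, and is
   moved next to the neighbouring [p' i] keeping its residue. *)
Lemma near_eq_extend (I : finType) (J : pred I) (p p' : I -> int)
    (D B X : int) :
  0 < D -> 0 <= B ->
  (forall i j, J i -> J j ->
     near_eq (2 * (B + D)) (p i - p j) (p' i - p' j)) ->
  (forall i, J i -> congz D (p i) (p' i)) ->
  exists X', [/\ congz D X' X,
    forall i, J i -> near_eq B (X - p i) (X' - p' i)
    & `|X'| <= B + D + \sum_(i | J i) `|p' i| ].
Proof.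
move=> D0 B0 near_p cong_p.
have bound i s : J i -> `|s| <= B + D ->
    `|p' i + s| <= B + D + \sum_(i | J i) `|p' i|.
  move=> Ji sW; rewrite (bigD1 i) //=.
  set r := (X in _ + (_ + X)); have r0 : 0 <= r by apply: sumr_ge0.
  move: r r0 => r r0; lia.
have [[i [Ji Xi]]|far] :=
  pselect (exists i, J i /\ `|X - p i| <= B + D).
  (* The offset from [p i] is kept; it costs at most [B + D] of the margin [2 * (B + D)]. *)
  exists (p' i + (X - p i)); split; last exact: bound.
    have [q pq] := cong_p _ Ji; exists (- q); rewrite pq; ring.
  move=> j Jj; have -> : p' i + (X - p i) - p' j = X - p i + (p' i - p' j) by ring.
  have -> : X - p j = X - p i + (p i - p j) by ring.
  by apply: near_eq_shift; apply: near_eqW (near_p _ _ Ji Jj); lia.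
have {}far i : J i -> B + D < `|X - p i|.
  by move=> Ji; rewrite ltNge; apply/negP => le; apply: far; exists i.
have move_up i s : J i -> congz D s (X - p i) -> congz D (p' i + s) X.
  move=> /cong_p [q pq] [r ->]; exists (r - q); rewrite pq; ring.
have [[i0 [Ji0 lt0]]|nobelow] := pselect (exists i, J i /\ p i < X).
  (* No point is near. [X'] is put above the image of the largest point [p i] below [X], at a
     distance in [(B, B + D]]. A point [p j] above [X] exceeds [p i] by more than [2 * (B + D)]; so
     does its image, which is thus more than [B] above [X']. *)
  pose K i := J i && (p i < X).
  have K0 : K i0 by rewrite /K Ji0.
  have [i /andP[Ji iX] imax] := arg_maxP p K0.
  have [s [cs s1 s2]] := congz_repr B (X - p i) D0.
  exists (p' i + s); split; [exact: move_up|move=> j Jj|by apply: bound => //; lia].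
  have := near_p _ _ Jj Ji; have := far _ Jj; have := far _ Ji.
  have [jX|Xj] := ltP (p j) X.
    have pji : p j <= p i by apply: imax; rewrite /K Jj.
    move=> h1 h2 h3; constructor 2; split; first by lia.
    have := near_eq_le0 _ h3; lia.
  move=> h1 h2 [h3|[h3 h4]|[h3 h4]]; constructor 3; split; lia.
have [[i0 Ji0]|noJ] := pselect (exists i, J i); last first.
  have [s [cs s1 s2]] := congz_repr 0 X D0.
  exists s; split => // [i Ji|]; first by case: noJ; exists i.
  set r := (X in _ + X); have r0 : 0 <= r by apply: sumr_ge0.
  move: r r0 => r r0; lia.
(* All points lie above [X]: mirror image of the previous case, with [X'] below the image of the
   smallest point. *)
have [i Ji imin] := arg_minP p Ji0.
have [s [cs s1 s2]] := congz_repr (- B - D - 1) (X - p i) D0.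
exists (p' i + s); split; [exact: move_up|move=> j Jj|by apply: bound => //; lia].
have := imin _ Jj => pij; have := near_p _ _ Ji Jj; have := far _ Jj.
have := far _ Ji.
have Xj : X <= p j by rewrite leNgt; apply/negP => h; apply: nobelow; exists j.
have Xi : X <= p i by rewrite leNgt; apply/negP => h; apply: nobelow; exists i.
move=> h1 h2 h3; constructor 3; split; first by lia.
have := near_eq_le0 _ h3; lia.
Qed.

(** * Environments, linear forms, and quantifier elimination as an invariance property *)

Definition env := nat -> int.
Definition scons (x : int) (e : env) : env :=
  fun i => if i is j.+1 then e j else x.
Definition behead_env (e : env) : env := fun i => e i.+1.

Lemma scons_behead e : scons (e 0%N) (behead_env e) = e.
Proof. by apply: funext => -[]. Qed.

Section Invariant.
Variables (R : idomainType) (ev : nat -> {rmorphism R -> int}).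

Definition lform (k t : nat) (c : nat -> R) (e : env) : int :=
  \sum_(i < k) ev t (c i) * e i.

Definition sim (k t : nat) (I : finType) (L : I -> nat -> R) (D B : int)
    (e e' : env) : Prop :=
  (forall i, (i < k)%N -> congz D (e i) (e' i)) /\
  (forall i, near_eq B (lform k t (L i) e) (lform k t (L i) e')).

(** A semantic form of quantifier elimination. [R] will be [int] for ordinary Presburger arithmetic
    and [{poly int}] for the parametric one; taking [L], [D] and [B] in [R] makes them uniform in
    [t]. *)
Definition sim_invariant (k : nat) (P : nat -> env -> Prop) : Prop :=
  exists (I : finType) (L : I -> nat -> R) (D B : R) (N : nat),
    forall t, (N <= t)%N ->
      [/\ 0 < ev t D, 0 <= ev t B &
          forall e e', sim k t L (ev t D) (ev t B) e e' -> P t e -> P t e'].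

Lemma sim_sym k t (I : finType) (L : I -> nat -> R) D B e e' :
  sim k t L D B e e' -> sim k t L D B e' e.
Proof.
by move=> [h1 h2]; split => [i /h1/congz_sym|i]; last exact: near_eq_sym.
Qed.

Lemma lform_scons k t c x e :
  lform k.+1 t c (scons x e) =
  ev t (c 0%N) * x + lform k t (fun i => c i.+1) e.
Proof. by rewrite /lform big_ord_recl. Qed.

Lemma lformZ k t a c e :
  lform k t (fun i => a * c i) e = ev t a * lform k t c e.
Proof.
by rewrite /lform mulr_sumr; apply: eq_bigr => i _; rewrite rmorphM mulrA.
Qed.

Lemma lformD k t c d e :
  lform k t (fun i => c i + d i) e = lform k t c e + lform k t d e.
Proof.
by rewrite /lform -big_split; apply: eq_bigr => i _ /=; rewrite rmorphD mulrDl.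
Qed.

Lemma lformB k t c d e :
  lform k t (fun i => c i - d i) e = lform k t c e - lform k t d e.
Proof.
by rewrite /lform -sumrB; apply: eq_bigr => i _; rewrite rmorphB mulrBl.
Qed.

Lemma lform_congz k t c D e e' :
  (forall i, (i < k)%N -> congz D (e i) (e' i)) ->
  congz D (lform k t c e) (lform k t c e').
Proof.
move=> h; rewrite /lform; elim/big_ind2: _ => [|x x' y y' [q ->] [r ->]|i _].
- by exists 0; ring.
- by exists (q + r); ring.
- by have [q ->] := h i (ltn_ord i); exists (ev t (c i) * q); ring.
Qed.

(** Integers satisfy [|c| <= c ^+ 2], and the square, unlike the absolute value, is again the value
    of an element of [R]. *)
Lemma lform_near_self k t c e :
  `|lform k t c e| <= (\sum_(i < k) ev t (c i) ^+ 2) * (1 + \sum_(i < k) `|e i|).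
Proof.
apply: le_trans (ler_norm_sum _ _ _) _; rewrite mulr_suml; apply: ler_sum => i _.
rewrite normrM (bigD1 i) //=; set r := \sum_(j < k | _) _.
have r0 : 0 <= r by apply: sumr_ge0.
have : `|ev t (c i)| <= ev t (c i) ^+ 2 by nia.
move: (ev t (c i)) (e i) r r0 => a b r r0; nia.
Qed.

Lemma sim_invariant_ext k P Q :
  (forall t e, P t e <-> Q t e) -> sim_invariant k P -> sim_invariant k Q.
Proof. by move=> PQ; rewrite (_ : P = Q) //; apply/funext => t; apply/funext => e; apply/propext. Qed.

Lemma sim_invariant_not k P : sim_invariant k P -> sim_invariant k (fun t e => ~ P t e).
Proof.
move=> [I [L [D [B [N H]]]]]; exists I, L, D, B, N => t /H [D0 B0 h]; split=> //.
by move=> e e' s nP /(h _ _ (sim_sym s)).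
Qed.

Lemma sim_invariant_and k P Q : sim_invariant k P -> sim_invariant k Q ->
  sim_invariant k (fun t e => P t e /\ Q t e).
Proof.
move=> [I [L [D [B [N H]]]]] [I' [L' [D' [B' [N' H']]]]].
exists (I + I')%type, (fun i => match i with inl i => L i | inr i => L' i end).
exists (D * D'), (B + B'), (maxn N N') => t; rewrite geq_max => /andP[Nt N't].
have [D0 B0 h] := H t Nt; have [D'0 B'0 h'] := H' t N't.
rewrite rmorphM rmorphD; split; [exact: mulr_gt0|exact: addr_ge0|].
move=> e e' [s1 s2] [Pe Qe]; split; [apply: h Pe|apply: h' Qe]; split.
- by move=> i /s1 [q ->]; exists (q * ev t D'); ring.
- by move=> i; apply: near_eqW (s2 (inl i)); lia.
- by move=> i /s1 [q ->]; exists (q * ev t D); ring.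
- by move=> i; apply: near_eqW (s2 (inr i)); lia.
Qed.

Lemma sim_invariant_le k (c : nat -> R) (b : R) :
  sim_invariant k (fun t e => lform k t c e + ev t b <= 0).
Proof.
(* Truncation at [b ^+ 2 >= |b|] still decides whether the form plus [b] is nonpositive. *)
exists unit, (fun _ => c), 1, (b ^+ 2), 0%N => t _; rewrite rmorph1 rmorphXn.
split=> //; first by rewrite sqr_ge0.
move=> e e' [_ /(_ tt)] [->|[h1 h2]|[h1 h2]] //; nia.
Qed.

Hypothesis ev_neq0 :
  forall r : R, r != 0 -> exists N, forall t, (N <= t)%N -> ev t r != 0.

(** Lets the elimination below decide in [R], once for all large [t], which coefficients vanish. *)
Lemma ev_neq0_fin (I : finType) (a : I -> R) :
  exists N, forall t i, (N <= t)%N -> a i != 0 -> ev t (a i) != 0.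
Proof.
have /choice [N HN] : forall i, exists N, a i != 0 -> forall t, (N <= t)%N -> ev t (a i) != 0.
  move=> i; have [->|/ev_neq0 [N HN]] := eqVneq (a i) 0; first by exists 0%N.
  by exists N.
exists (\max_i N i)%N => t i le ai; apply: HN => //.
by apply: leq_trans le; apply: leq_bigmax.
Qed.

Definition ex_env (P : nat -> env -> Prop) t e := exists x, P t (scons x e).

(* Multiplying the form [a i * x + c i] by [d i] gives all forms that involve
   [x] the same coefficient [A]. *)
Lemma sim_invariant_ex_bounded k P : sim_invariant k.+1 P ->
  sim_invariant k (ex_env P) /\
  exists (E : R) (N : nat), forall t, (N <= t)%N -> 0 <= ev t E /\
    forall e, ex_env P t e ->
      exists x, `|x| <= ev t E * (1 + \sum_(i < k) `|e i|) /\ P t (scons x e).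
Proof.
move=> [I [L [D [B [N H]]]]].
pose a i := L i 0%N; pose c i := fun j => L i j.+1.
have [N1 HN1] := ev_neq0_fin a.
pose A := \prod_(i | a i != 0) a i.
pose d i := \prod_(j | (a j != 0) && (j != i)) a j.
have adA i : a i != 0 -> A = a i * d i by move=> ai; rewrite /A (bigD1 i).
have d0 i : d i != 0 by apply/prodf_neq0 => j /andP[].
have [N2 HN2] := ev_neq0_fin d.
pose dc i := fun j => d i * c i j.
(* A number congruent to [A * x] modulo [A ^+ 2 * D] has the form [A * x'] with [x'] congruent to
   [x] modulo [A * D]. *)
pose D' := A ^+ 2 * D.
(* At least [B * |d i|] for every [i], which pays for the later division by [d i]. *)
pose B2 := B * \sum_i d i ^+ 2.
pose I' := (I + I * I)%type.
(* The [c i] serve the forms without [x]. The differences compare the points [- dc i], around which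
   [A * x] moves because [d i * (a i * x + c i) = A * x + dc i]. *)
pose L' (i : I') := match i with inl i => c i
  | inr (i, j) => fun s => dc i s - dc j s end.
pose B' := 2 * (B2 + D') + B.
pose E := B2 + D' + \sum_i \sum_(j < k) dc i j ^+ 2.
pose N' := maxn N (maxn N1 N2).
have main t : (N' <= t)%N ->
  [/\ 0 < ev t D', 0 <= ev t B', 0 <= ev t E &
   forall y y' x, sim k t L' (ev t D') (ev t B') y y' ->
     P t (scons x y) -> exists x', P t (scons x' y') /\
      `|x'| <= ev t E * (1 + \sum_(i < k) `|y' i|)].
  rewrite /N' !geq_max => /and3P[Nt N1t N2t].
  have [D0 B0 h] := H t Nt.
  have A0 : ev t A != 0.
    by rewrite rmorph_prod; apply/prodf_neq0 => i ai; apply: HN1.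
  have A1 : 0 < ev t A ^+ 2 by rewrite exprn_even_gt0.
  have D'0 : 0 < ev t D' by rewrite rmorphM rmorphXn mulr_gt0.
  have B20 : 0 <= ev t B2.
    rewrite rmorphM rmorph_sum mulr_ge0 // sumr_ge0 // => i _.
    by rewrite rmorphXn sqr_ge0.
  have B2E : ev t B' = 2 * (ev t B2 + ev t D') + ev t B.
    by rewrite rmorphD rmorphM [ev t (B2 + D')]rmorphD rmorph_nat.
  have E_ge0 : 0 <= \sum_i \sum_(j < k) ev t (dc i j) ^+ 2.
    by apply: sumr_ge0 => i _; apply: sumr_ge0 => j _; apply: sqr_ge0.
  have EE : ev t E = ev t B2 + ev t D' + \sum_i \sum_(j < k) ev t (dc i j) ^+ 2.
    rewrite !rmorphD rmorph_sum; congr (_ + _); apply: eq_bigr => i _.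
    by rewrite rmorph_sum; apply: eq_bigr => j _; rewrite rmorphXn.
  split=> //; first by rewrite B2E; lia.
    by rewrite EE addr_ge0 // addr_ge0 // ltW.
  move=> y y' x [s1 s2] Pxy.
  pose p i := - lform k t (dc i) y; pose p' i := - lform k t (dc i) y'.
  have [|i _|X' [[q X'E] nearX' boundX']] :=
      @near_eq_extend I (fun i => a i != 0) p p' (ev t D') (ev t B2)
        (ev t A * x) D'0 B20.
  - move=> i j _ _; rewrite /p /p'.
    have := s2 (inr (j, i)); rewrite /= !lformB !opprK.
    rewrite ![- _ + _]addrC; apply: near_eqW; rewrite B2E; lia.
  - rewrite /p /p'; have [q ->] := lform_congz t (dc i) s1.
    by exists (- q); ring.
  pose x' := x + q * (ev t A * ev t D).
  have X'A : X' = ev t A * x' by rewrite X'E rmorphM rmorphXn /x'; ring.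
  exists x'; split.
    apply: h Pxy; split=> [[_|i ik]|i] /=.
    + by exists (- q * ev t A); rewrite /x'; ring.
    + have [r ->] := s1 i ik; exists (r * ev t A ^+ 2).
      by rewrite rmorphM rmorphXn; ring.
    rewrite !lform_scons -/(a i) -/(c i).
    have [ai0|ai0] := eqVneq (a i) 0.
      rewrite ai0 rmorph0 !mul0r !add0r.
      by apply: near_eqW (s2 (inl i)); rewrite B2E; lia.
    have di := HN2 t i N2t (d0 i).
    apply: (@near_eq_scale _ (ev t B2) (ev t (d i))) => //.
      rewrite rmorphM ler_wpM2l // rmorph_sum (bigD1 i) //= rmorphXn.
      set r := (X in _ + X); have r0 : 0 <= r.
        by apply: sumr_ge0 => j _; rewrite rmorphXn sqr_ge0.
      move: (ev t (d i)) r r0 => u r r0; nia.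
    have := nearX' i ai0; rewrite X'A /p /p' !opprK /dc !lformZ (adA i ai0) rmorphM.
    congr near_eq; ring.
  have x'X' : `|x'| <= `|X'|.
    by rewrite X'A normrM ler_peMl // -gtz0_ge1 normr_gt0.
  apply: le_trans x'X' _; apply: le_trans boundX' _; rewrite EE mulrDl.
  have S0 : 0 <= \sum_(i < k) `|y' i| by apply: sumr_ge0.
  apply: lerD.
    by apply: ler_peMr; rewrite ?lerDl // addr_ge0 // ltW.
  rewrite mulr_suml big_mkcond /=; apply: ler_sum => i _.
  rewrite /p' normrN; case: ifP => _; first exact: lform_near_self.
  apply: mulr_ge0; last by rewrite addr_ge0.
  by apply: sumr_ge0 => j _; apply: sqr_ge0.
split.
  exists I', L', D', B', N' => t /main [D'0 B'0 _ h]; split=> //.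
  by move=> e e' s [x Px]; have [x' [Px' _]] := h _ _ _ s Px; exists x'.
exists E, N' => t /main [D'0 B'0 E0 h]; split=> // e [x Px].
(* The round played from [e] to itself trades a witness for a bounded one. *)
have [|x' [Px' bx']] := h e e x _ Px; last by exists x'.
by split=> i *; [exists 0; ring|constructor 1].
Qed.

End Invariant.

(** * The two evaluations, and ordinary Presburger sets *)

Definition evZ (t : nat) : {rmorphism int -> int} := idfun.
Definition evP (t : nat) : {rmorphism {poly int} -> int} := horner_eval t%:Z.

Lemma evZ_neq0 (r : int) :
  r != 0 -> exists N, forall t, (N <= t)%N -> evZ t r != 0.
Proof. by exists 0%N. Qed.

(** Induction in Horner form: once [p] takes a nonzero integer value at [t > |c|], the product with
    [t] dominates [c]. *)
Lemma evP_neq0 (p : {poly int}) :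
  p != 0 -> exists N, forall t, (N <= t)%N -> evP t p != 0.
Proof.
elim/poly_ind: p => [|p c IH]; first by rewrite eqxx.
have [->|/IH [N HN]] := eqVneq p 0 => [|_].
  rewrite mul0r add0r polyC_eq0 => c0; exists 0%N => t _.
  by rewrite /evP /= /horner_eval hornerC.
exists (maxn N `|c|.+1) => t; rewrite geq_max => /andP[/HN Nt ct].
move: Nt; rewrite /evP /= /horner_eval hornerMXaddC.
move: p.[_] => u u0; apply/negP => /eqP; nia.
Qed.

(** Presburger sets enter through the invariance property and not through a syntax; over [int] the
    modulus and the truncation bound are fixed integers. *)
Definition pres (n : nat) (Q : env -> Prop) := sim_invariant evZ n (fun _ e => Q e).

Definition affine (n : nat) (u : env -> int) :=
  exists (c : nat -> int) (z : int),
    forall e, u e = \sum_(i < n) c i * e i + z.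

Lemma affine_ext n u v : u =1 v -> affine n u -> affine n v.
Proof. by move=> /funext ->. Qed.

Lemma affine_const n z : affine n (fun=> z).
Proof. by exists (fun=> 0), z => e; rewrite big1 ?add0r // => i _; rewrite mul0r. Qed.

Lemma affine_var n i : (i < n)%N -> affine n (fun e => e i).
Proof.
move=> ik; exists (fun j => (j == i)%:Z), 0 => e.
rewrite (bigD1 (Ordinal ik)) //= eqxx big1 ?addr0 ?mul1r // => j.
by rewrite -val_eqE /= => /negbTE ->; rewrite mul0r.
Qed.

Lemma affine_add n u v : affine n u -> affine n v -> affine n (fun e => u e + v e).
Proof.
move=> [c [z uE]] [d [w vE]]; exists (fun i => c i + d i), (z + w) => e.
rewrite uE vE addrACA -big_split; congr (_ + _).
by apply: eq_bigr => i _; rewrite /= mulrDl.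
Qed.

Lemma affine_scale n a u : affine n u -> affine n (fun e => a * u e).
Proof.
move=> [c [z uE]]; exists (fun i => a * c i), (a * z) => e.
by rewrite uE mulrDr mulr_sumr; congr (_ + _); apply: eq_bigr => i _; rewrite mulrA.
Qed.

Lemma affine_opp n u : affine n u -> affine n (fun e => - u e).
Proof. by move/(affine_scale (-1)); apply: affine_ext => e; rewrite mulN1r. Qed.

Lemma affine_behead n u : affine n u -> affine n.+1 (fun e => u (behead_env e)).
Proof.
move=> [c [z uE]]; exists (fun i => if i is j.+1 then c j else 0), z => e.
by rewrite uE big_ord_recl mul0r add0r.
Qed.

Lemma pres_ext n P Q : pres n P -> (forall e, P e <-> Q e) -> pres n Q.
Proof. by move=> hP PQ; apply: sim_invariant_ext hP. Qed.

Lemma pres_not n P : pres n P -> pres n (fun e => ~ P e).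
Proof. exact: sim_invariant_not. Qed.

Lemma pres_and n P Q : pres n P -> pres n Q -> pres n (fun e => P e /\ Q e).
Proof. exact: sim_invariant_and. Qed.

Lemma pres_or n P Q : pres n P -> pres n Q -> pres n (fun e => P e \/ Q e).
Proof.
move=> /pres_not hP /pres_not hQ; have := pres_not (pres_and hP hQ).
by move=> h; apply: (pres_ext h) => e; rewrite -not_orP notE.
Qed.

Lemma pres_le n u v : affine n u -> affine n v -> pres n (fun e => u e <= v e).
Proof.
move=> hu hv; have [c [z uvE]] := affine_add hu (affine_opp hv).
apply: sim_invariant_ext (sim_invariant_le evZ n c z) => t e.
by rewrite -[in X in _ <-> X]subr_le0 uvE.
Qed.

Lemma pres_lt n u v : affine n u -> affine n v -> pres n (fun e => u e < v e).
Proof.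
move=> hu hv; apply: (pres_ext (pres_le (affine_add hu (affine_const n 1)) hv)).
by move=> e; rewrite lezD1.
Qed.

Lemma pres_eq n u v : affine n u -> affine n v -> pres n (fun e => u e = v e).
Proof.
move=> hu hv; apply: (pres_ext (pres_and (pres_le hu hv) (pres_le hv hu))) => e.
by split=> [[h1 h2]|->] //; apply/eqP; rewrite eq_le h1.
Qed.

Lemma pres_ex n (P : env -> int -> Prop) :
  pres n.+1 (fun e => P (behead_env e) (e 0%N)) ->
  pres n (fun e => exists x, P e x).
Proof. by move=> /(sim_invariant_ex_bounded evZ_neq0) []. Qed.

Lemma pres_subst n u P : affine n u -> pres n.+1 P ->
  pres n (fun e => P (scons (u e) e)).
Proof.
move=> hu hP.
have : pres n (fun e => exists x, x = u e /\ P (scons x e)).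
  apply: pres_ex; apply: pres_and.
    by apply: pres_eq; [exact: affine_var|exact: affine_behead].
  by apply: (pres_ext hP) => e; rewrite scons_behead.
by move=> h; apply: (pres_ext h) => e; split=> [[x [-> //]]|]; exists (u e).
Qed.

(** * Digits *)

(* The coordinate [tau] holds the parameter [t], and the other coordinates are
   digits in base [t] of either sign. *)
Definition in_box (N n tau : nat) (e : env) :=
  N%:Z <= e tau /\ forall i, (i < n)%N -> `|e i| <= e tau.

Lemma in_boxW N N' n tau e : (N <= N')%N -> in_box N' n tau e -> in_box N n tau e.
Proof. by move=> le [h1 h2]; split=> //; lia. Qed.

(** Agreement is asked on boxes only: there the carries that replace multiplication by [e tau] take
    finitely many values. *)
Definition box_pres n tau (P : env -> Prop) := exists (Q : env -> Prop) (N : nat),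
  pres n Q /\ forall e, in_box N n tau e -> (P e <-> Q e).

Lemma box_pres_ext N n tau P P' : box_pres n tau P ->
  (forall e, in_box N n tau e -> (P e <-> P' e)) -> box_pres n tau P'.
Proof.
move=> [Q [N' [hQ PQ]]] PP'; exists Q, (maxn N N'); split=> // e b.
by rewrite -PP' ?PQ //; apply: in_boxW b; rewrite ?leq_maxl ?leq_maxr.
Qed.

Lemma box_pres_pres n tau P : pres n P -> box_pres n tau P.
Proof. by move=> hP; exists P, 0%N. Qed.

Lemma box_pres_not n tau P : box_pres n tau P -> box_pres n tau (fun e => ~ P e).
Proof.
move=> [Q [N [hQ PQ]]]; exists (fun e => ~ Q e), N; split; first exact: pres_not.
by move=> e /PQ ->.
Qed.

Lemma box_pres_and n tau P P' : box_pres n tau P -> box_pres n tau P' ->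
  box_pres n tau (fun e => P e /\ P' e).
Proof.
move=> [Q [N [hQ PQ]]] [Q' [N' [hQ' PQ']]].
exists (fun e => Q e /\ Q' e), (maxn N N'); split; first exact: pres_and.
by move=> e b; rewrite PQ ?PQ' //; apply: in_boxW b; rewrite ?leq_maxl ?leq_maxr.
Qed.

Lemma box_pres_or n tau P P' : box_pres n tau P -> box_pres n tau P' ->
  box_pres n tau (fun e => P e \/ P' e).
Proof.
move=> /box_pres_not hP /box_pres_not hQ.
have := box_pres_not (box_pres_and hP hQ).
by move=> h; apply: (box_pres_ext (N := 0) h) => e _; rewrite -not_orP notE.
Qed.

Lemma box_pres_ex_lt n tau (P : nat -> env -> Prop) K :
  (forall j, box_pres n tau (P j)) ->
  box_pres n tau (fun e => exists j, (j < K)%N /\ P j e).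
Proof.
move=> hP; elim: K => [|K IH].
  have := box_pres_pres tau (pres_le (affine_const n 1) (affine_const n 0)).
  by move=> h; apply: (box_pres_ext (N := 0) h) => e _; split=> // -[j []].
apply: (box_pres_ext (N := 0) (box_pres_or IH (hP K))) => e _; split.
  by case=> [[j [jK Pj]]|PK]; [exists j; split=> //; exact: ltnW|exists K].
move=> [j [jK Pj]]; move: jK; rewrite ltnS leq_eqVlt => /orP[/eqP <-|jK]; first by right.
by left; exists j.
Qed.

Lemma box_pres_ex_digit n tau P : (tau < n)%N -> box_pres n.+1 tau.+1 P ->
  box_pres n tau (fun e => exists x, `|x| < e tau /\ P (scons x e)).
Proof.
move=> tn [Q [N [hQ PQ]]].
exists (fun e => exists x, (- e tau < x /\ x < e tau) /\ Q (scons x e)), N; split.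
  apply: pres_ex; apply: pres_and; last first.
    by apply: (pres_ext hQ) => e; rewrite scons_behead.
  by apply: pres_and; apply: pres_lt; try apply: affine_opp; apply: affine_var.
have bx e x : in_box N n tau e -> `|x| < e tau -> in_box N n.+1 tau.+1 (scons x e).
  by move=> [h1 h2] hx; split=> // -[_|i /h2] //=; apply: ltW.
move=> e b; split=> -[x [h1 h2]]; exists x.
  by split; [apply/andP; rewrite -ltr_norml|rewrite -PQ //; exact: bx].
by move/andP: h1; rewrite -ltr_norml => h1; split=> //; rewrite PQ //; exact: bx.
Qed.

Lemma affine_box_bound n tau u : affine n u ->
  exists K : nat, forall e, in_box 1 n tau e -> `|u e| <= K%:Z * e tau.
Proof.
move=> [c [z uE]]; exists (absz (\sum_(i < n) `|c i| + `|z|)) => e [t1 b].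
have S0 : 0 <= \sum_(i < n) `|c i| + `|z| by rewrite addr_ge0 // sumr_ge0.
rewrite uE abszE (ger0_norm S0).
apply: le_trans (ler_normD _ _) _; rewrite mulrDl; apply: lerD.
  rewrite mulr_suml; apply: le_trans (ler_norm_sum _ _ _) _; apply: ler_sum => i _.
  by rewrite normrM ler_wpM2l // b.
by apply: ler_peMr.
Qed.

(* Polynomials in [e tau] with affine coefficients, in Horner form. *)
Inductive tpoly (n tau : nat) : (env -> int) -> Prop :=
| tpoly_affine u : affine n u -> tpoly n tau u
| tpoly_horner u v : affine n u -> tpoly n tau v ->
    tpoly n tau (fun e => u e + e tau * v e).

(** With [t = e tau], [s + t * v <= 0] holds iff the carry, [s / t] rounded up, satisfies
    [carry + v <= 0]. For affine [s] the carry lies in [[-K, K]] on the box, so a finite disjunction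
    over its values removes one power of [t]. The induction is over an added affine [u] that absorbs
    the carry. *)
Lemma box_pres_tpoly_le0 n tau v : (tau < n)%N -> tpoly n tau v ->
  box_pres n tau (fun e => v e <= 0).
Proof.
move=> tn hv.
suff /(_ _ (affine_const n 0)) : forall u, affine n u -> box_pres n tau (fun e => u e + v e <= 0).
  by move=> h; apply: (box_pres_ext (N := 0) h) => e _; rewrite add0r.
elim: hv => {v} [u' hu'|u' v hu' _ IH] u hu.
  by apply/box_pres_pres/pres_le; [exact: affine_add|exact: affine_const].
have huu := affine_add hu hu'; have [K hK] := affine_box_bound tau huu.
have ht := affine_var tn.
pose q (j : nat) : int := j%:Z - K%:Z.
have : box_pres n tau (fun e => exists j, (j < K.*2.+1)%N /\
   (((q j - 1) * e tau < u e + u' e /\ u e + u' e <= q j * e tau)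
      /\ q j + v e <= 0)).
  apply: box_pres_ex_lt => j; apply: box_pres_and; last exact/IH/affine_const.
  by apply/box_pres_pres/pres_and; [apply: pres_lt|apply: pres_le] => //;
    apply: affine_scale.
move=> h; apply: (box_pres_ext (N := 1) h) => e b.
have := hK e b; have [t1 _] := b; rewrite addrA.
move: (u e + u' e) (v e) (e tau) t1 => s w t t1 sK; split.
  move=> [j [jK [[h1 h2] h3]]]; move: (q j) h1 h2 h3 => z h1 h2 h3; nia.
(* [z] is [s / t] rounded up. *)
move=> le0; pose z := - ((- s) %/ t)%Z.
have t0 : t != 0 by lia.
have zE : - s = - z * t + (- s %% t)%Z by rewrite /z opprK -divz_eq.
have m0 := modz_ge0 (- s) t0; have mt : (- s %% t)%Z < t by apply: ltz_pmod; lia.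
move: z (- s %% t)%Z zE m0 mt => z m zE m0 mt.
have zK : - K%:Z <= z <= K%:Z by apply/andP; split; nia.
exists (absz (z + K%:Z)); rewrite /q; have -> : (absz (z + K%:Z))%:Z - K%:Z = z by lia.
split; [lia|split; [split|]]; nia.
Qed.

Lemma tpoly_add n tau v w : tpoly n tau v -> tpoly n tau w ->
  tpoly n tau (fun e => v e + w e).
Proof.
move=> hv; elim: hv w => {v} [u hu|u v hu hv IH] w [u' hu'|u' v' hu' hv'].
- by apply/tpoly_affine/affine_add.
- have -> : (fun e => u e + (u' e + e tau * v' e)) =
     (fun e => (u e + u' e) + e tau * v' e) by apply: funext => e; ring.
  by apply: tpoly_horner => //; exact: affine_add.
- have -> : (fun e => u e + e tau * v e + u' e) =
     (fun e => (u e + u' e) + e tau * v e) by apply: funext => e; ring.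
  by apply: tpoly_horner => //; exact: affine_add.
- have -> : (fun e => u e + e tau * v e + (u' e + e tau * v' e)) =
     (fun e => (u e + u' e) + e tau * (v e + v' e)) by apply: funext => e; ring.
  by apply: tpoly_horner; [exact: affine_add|exact: IH].
Qed.

Lemma tpoly_scale n tau a v : tpoly n tau v -> tpoly n tau (fun e => a * v e).
Proof.
elim=> {v} [u hu|u v hu _ IH]; first by apply/tpoly_affine/affine_scale.
have -> : (fun e => a * (u e + e tau * v e)) = (fun e => a * u e + e tau * (a * v e)).
  by apply: funext => e; ring.
by apply: tpoly_horner => //; exact: affine_scale.
Qed.

Lemma tpoly_mult n tau v : tpoly n tau v -> tpoly n tau (fun e => e tau * v e).
Proof.
move=> hv; have := tpoly_horner (affine_const n 0) hv.
by congr tpoly; apply: funext => e; rewrite add0r.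
Qed.

Lemma tpoly_poly n tau (p : {poly int}) v : tpoly n tau v ->
  tpoly n tau (fun e => p.[e tau] * v e).
Proof.
elim/poly_ind: p v => [|p c IH] v hv.
  have := tpoly_scale 0 hv; congr tpoly; apply: funext => e; rewrite horner0; ring.
have := tpoly_add (IH _ (tpoly_mult hv)) (tpoly_scale c hv).
by congr tpoly; apply: funext => e; rewrite hornerMXaddC; ring.
Qed.

Lemma tpoly_sum n tau k (v : nat -> env -> int) :
  (forall j, (j < k)%N -> tpoly n tau (v j)) ->
  tpoly n tau (fun e => \sum_(j < k) v j e).
Proof.
elim: k => [|k IH] hv.
  have := tpoly_affine tau (affine_const n 0); congr tpoly; apply: funext => e.
  by rewrite big_ord0.
have := tpoly_add (IH (fun j jk => hv j (leqW jk))) (hv k (ltnSn k)); congr tpoly; apply: funext => e.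
by rewrite big_ord_recr.
Qed.

Lemma tpoly_behead n tau v : tpoly n tau v ->
  tpoly n.+1 tau.+1 (fun e => v (behead_env e)).
Proof.
elim=> {v} [u hu|u v hu _ IH]; first by apply/tpoly_affine/affine_behead.
by apply: tpoly_horner => //; exact: affine_behead.
Qed.

(** The exponent [r] will be the number of base [e tau] digits needed to write the value. *)
Definition pol_bounded n tau (v : env -> int) := exists r N : nat,
  forall e, in_box N n tau e -> `|v e| <= e tau ^+ r.

Lemma pol_boundedW n tau (v : env -> int) r N : (forall e, in_box N n tau e -> `|v e| <= e tau ^+ r) ->
  forall r', (r <= r')%N ->
  forall e, in_box (maxn 1 N) n tau e -> `|v e| <= e tau ^+ r'.
Proof.
move=> h r' le e b; apply: le_trans (h _ (in_boxW (leq_maxr _ _) b)) _.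
by have [b1 _] := in_boxW (leq_maxl _ _) b; apply: ler_weXn2l.
Qed.

Lemma pol_bounded_add n tau v w : pol_bounded n tau v -> pol_bounded n tau w ->
  pol_bounded n tau (fun e => v e + w e).
Proof.
move=> [r [N h]] [r' [N' h']]; exists (maxn r r').+1, (maxn 2 (maxn (maxn 1 N) (maxn 1 N'))).
move=> e b; have [b2 _] := in_boxW (leq_maxl _ _) b.
have {}b := in_boxW (leq_maxr _ _) b.
have h1 := pol_boundedW h (leq_maxl r r') (in_boxW (leq_maxl _ _) b).
have h2 := pol_boundedW h' (leq_maxr r r') (in_boxW (leq_maxr _ _) b).
apply: le_trans (ler_normD _ _) _; rewrite exprS.
move: (_ ^+ _) h1 h2 => s h1 h2; nia.
Qed.

Lemma pol_bounded_mul n tau v w : pol_bounded n tau v -> pol_bounded n tau w ->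
  pol_bounded n tau (fun e => v e * w e).
Proof.
move=> [r [N h]] [r' [N' h']]; exists (r + r')%N, (maxn N N') => e b.
by rewrite normrM exprD ler_pM // ?h ?h' //; apply: in_boxW b; rewrite ?leq_maxl ?leq_maxr.
Qed.

Lemma pol_bounded_const n tau z : pol_bounded n tau (fun=> z).
Proof. by exists 1%N, `|z|%N => e [b _]; rewrite expr1; lia. Qed.

Lemma pol_bounded_var n tau i : (i < n)%N -> pol_bounded n tau (fun e => e i).
Proof. by move=> ik; exists 1%N, 0%N => e [_ b]; rewrite expr1 b. Qed.

Lemma pol_bounded_norm n tau v : pol_bounded n tau v ->
  pol_bounded n tau (fun e => `|v e|).
Proof. by move=> [r [N h]]; exists r, N => e /h; rewrite normr_id. Qed.

Lemma pol_bounded_sum n tau k (v : nat -> env -> int) :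
  (forall j, pol_bounded n tau (v j)) ->
  pol_bounded n tau (fun e => \sum_(j < k) v j e).
Proof.
move=> hv; elim: k => [|k IH].
  have := pol_bounded_const n tau 0; congr pol_bounded; apply: funext => e.
  by rewrite big_ord0.
have := pol_bounded_add IH (hv k); congr pol_bounded; apply: funext => e.
by rewrite big_ord_recr.
Qed.

Lemma pol_bounded_poly n tau (p : {poly int}) : (tau < n)%N ->
  pol_bounded n tau (fun e => p.[e tau]).
Proof.
move=> tn; elim/poly_ind: p => [|p c IH].
  have := pol_bounded_const n tau 0; congr pol_bounded; apply: funext => e.
  by rewrite horner0.
have := pol_bounded_add (pol_bounded_mul IH (pol_bounded_var tau tn)) (pol_bounded_const n tau c).
by congr pol_bounded; apply: funext => e; rewrite hornerMXaddC.
Qed.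

Lemma affine_bounded n tau u : affine n u -> pol_bounded n tau u.
Proof.
move=> /(affine_box_bound tau) [K hK]; exists 2%N, (maxn 1 K) => e b.
apply: le_trans (hK _ (in_boxW (leq_maxl _ _) b)) _.
have [b' _] := b; rewrite expr2; move: (e tau) b' => t; nia.
Qed.

Lemma tpoly_bounded n tau v : (tau < n)%N -> tpoly n tau v -> pol_bounded n tau v.
Proof.
move=> tn; elim=> {v} [u hu|u v hu _ IH]; first exact: affine_bounded.
apply: pol_bounded_add; first exact: affine_bounded.
by apply: pol_bounded_mul IH; exact: pol_bounded_var.
Qed.

(** * Parametric Presburger families *)

(** Formulas are represented by their meanings; induction on a derivation plays the role of
    induction on a formula. *)
Inductive ppa : nat -> (nat -> env -> Prop) -> Prop :=
| ppa_lform k (c : nat -> {poly int}) (b : {poly int}) :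
    ppa k (fun t e => lform evP k t c e + evP t b <= 0)
| ppa_not k P : ppa k P -> ppa k (fun t e => ~ P t e)
| ppa_and k P Q : ppa k P -> ppa k Q -> ppa k (fun t e => P t e /\ Q t e)
| ppa_ex_env k P : ppa k.+1 P -> ppa k (ex_env P).

Lemma ppa_sim_invariant k P : ppa k P -> sim_invariant evP k P.
Proof.
elim=> {k P} [k c b|k P _ IH|k P Q _ IHP _ IHQ|k P _ IH].
- exact: sim_invariant_le.
- exact: sim_invariant_not.
- exact: sim_invariant_and.
- by have [] := sim_invariant_ex_bounded evP_neq0 IH.
Qed.

Definition cons_fun (x : env -> int) (v : nat -> env -> int) : nat -> env -> int :=
  fun j => if j is i.+1 then v i else x.

(** Each variable [j] is replaced by [v j], a polynomial in the parameter whose coefficients are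
    affine in digits. Atoms become inequalities between such polynomials, and a quantifier becomes a
    fixed number of quantifiers over digits. *)
Lemma ppa_box_pres k P : ppa k P ->
  forall n tau (v : nat -> env -> int), (tau < n)%N ->
  (forall j, tpoly n tau (v j)) ->
  box_pres n tau (fun e => P `|e tau|%N (v^~ e)).
Proof.
elim=> {k P} [k c b|k P _ IH|k P Q _ IHP _ IHQ|k P pP IH] n tau v tn hv.
- have := box_pres_tpoly_le0 tn (tpoly_add
    (tpoly_sum (k := k) (fun j _ => tpoly_poly (c j) (hv j)))
    (tpoly_poly b (tpoly_affine tau (affine_const n 1)))).
  move=> h; apply: (box_pres_ext (N := 0) h) => e [b0 _].
  by rewrite /lform /evP /= /horner_eval mulr1 gez0_abs.
- by apply: box_pres_not; exact: IH.
- by apply: box_pres_and; [exact: IHP|exact: IHQ].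
(* A witness can be bounded polynomially in the parameter and the [v j], hence by a power of the
   parameter. *)
have [_ [E [N0 bE]]] := sim_invariant_ex_bounded evP_neq0 (ppa_sim_invariant pP).
have [r [N1 br]] : pol_bounded n tau
    (fun e => E.[e tau] * (1 + \sum_(j < k) `|v j e|)).
  apply: pol_bounded_mul; first exact: pol_bounded_poly.
  apply: pol_bounded_add; first exact: pol_bounded_const.
  by apply: (@pol_bounded_sum _ _ _ (fun j e => `|v j e|)) => j; apply: pol_bounded_norm; exact: tpoly_bounded.
(* [w] collects the digits of the witness chosen so far, and [e tau ^+ s] is the place value of the
   next one. Induction on [r] writes [x] as [d + e tau * x'] with a new digit variable [d]. *)
suff digits : forall r s w n tau v, (tau < n)%N -> tpoly n tau w ->
    (forall j, tpoly n tau (v j)) ->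
    box_pres n tau (fun e => exists x, `|x| < e tau ^+ r /\
      P `|e tau|%N ((cons_fun (fun e => w e + e tau ^+ s * x) v)^~ e)).
  have := digits r.+1 0%N _ n tau v tn (tpoly_affine tau (affine_const n 0)) hv.
  move=> h; apply: (box_pres_ext (N := (maxn (maxn N0 2) N1)) h) => e b.
  have consE x : ((cons_fun (fun e => 0 + e tau ^+ 0 * x) v)^~ e) = scons x (v^~ e).
    by apply: funext => -[|j] //=; rewrite expr0 mul1r add0r.
  split=> [[x [_]]|hex]; first by rewrite consE; exists x.
  have [b1 _] := in_boxW (leq_maxl _ _) b.
  have [_ /(_ _ hex) [x [bx Px]]] := bE `|e tau|%N ltac:(lia).
  exists x; split; last by rewrite consE.
  have := br e (in_boxW (leq_maxr _ _) b).
  have <- : evP `|e tau| E = E.[e tau].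
    by rewrite /evP /= /horner_eval gez0_abs //; lia.
  move=> le; apply: le_lt_trans bx _; apply: le_lt_trans (ler_norm _) _.
  apply: le_lt_trans le _; rewrite exprS ltr_pMl; first by lia.
  by apply: exprn_gt0; lia.
move=> {n tau v tn hv N0 bE N1 br E} {}r; elim: r => [|r IHr] s w n tau v tn hw hv.
  have hc : forall j, tpoly n tau (cons_fun w v j) by case.
  apply: (box_pres_ext (N := 0) (IH _ _ _ tn hc)) => e _.
  have -> : (cons_fun w v)^~ e = (cons_fun (fun e => w e + e tau ^+ s * 0) v)^~ e.
    by apply: funext => -[|j] //=; rewrite mulr0 addr0.
  split=> [h|[x [x0]]]; first by exists 0; split.
  by have -> : x = 0 by move: x0; rewrite expr0; lia.
have tn' : (tau.+1 < n.+1)%N by [].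
have hX : tpoly n.+1 tau.+1 (fun e => e tau.+1 ^+ s * e 0%N).
  have := tpoly_poly ('X^s) (tpoly_affine tau.+1 (affine_var (ltn0Sn n))).
  by congr tpoly; apply: funext => e; rewrite hornerXn.
have := IHr s.+1 _ n.+1 tau.+1 _ tn' (tpoly_add (tpoly_behead hw) hX) (fun j => tpoly_behead (hv j)).
move=> /(box_pres_ex_digit tn).
move=> h; apply: (box_pres_ext (N := 1) h) => e [t1 _].
have consE d x :
  (cons_fun (fun e => w (behead_env e) + e tau.+1 ^+ s * e 0%N
      + e tau.+1 ^+ s.+1 * x) (fun j e => v j (behead_env e)))^~ (scons d e) =
  (cons_fun (fun e' => w e' + e' tau ^+ s * (d + e tau * x)) v)^~ e.
  apply: funext => -[|j] //=; rewrite exprS -!addrA; congr (_ + _).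
  by rewrite mulrDr mulrCA mulrA.
have tr0 : 1 <= e tau ^+ r by rewrite exprn_ege1.
split=> [[d [d1 [x [x1]]]]|[x [x1 Px]]].
  rewrite consE => hx; exists (d + e tau * x); split; last exact: hx.
  move: x1; rewrite exprS /=; move: (e tau) (_ ^+ r) d1 tr0 t1 => t s' d1 tr0 t1 x1.
  nia.
(* Digit and quotient both carry the sign of [x]: rounding down a negative [x] could push the
   quotient to [- e tau ^+ r]. *)
exists (sgz x * (`|x| %% e tau)%Z); split.
  have m0 : 0 <= (`|x| %% e tau)%Z by apply: modz_ge0; lia.
  have mt : (`|x| %% e tau)%Z < e tau by apply: ltz_pmod; lia.
  move: (`|x| %% e tau)%Z m0 mt => m m0 mt; case: (sgzP x) => _; nia.
exists (sgz x * (`|x| %/ e tau)%Z); split; last first.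
  rewrite consE mulrCA -mulrDr [e tau * _]mulrC addrC -divz_eq.
  by have -> : sgz x * `|x| = x :> int by case: (sgzP x) => hs; lia.
have t0 : 0 < e tau by lia.
have q0 : 0 <= (`|x| %/ e tau)%Z by rewrite divz_ge0.
have qr : (`|x| %/ e tau)%Z < e tau ^+ r.
  rewrite ltz_divLR //; move: x1; rewrite exprS; lia.
move: (`|x| %/ e tau)%Z q0 qr => m m0 mt /=; case: (sgzP x) => _; lia.
Qed.

(** * Counting lattice points of Presburger sets *)

Inductive pol (n : nat) : (env -> rat) -> Prop :=
| pol_const z : pol n (fun=> z)
| pol_add p q : pol n p -> pol n q -> pol n (fun e => p e + q e)
| pol_mulvar i p : (i < n)%N -> pol n p -> pol n (fun e => (e i)%:~R * p e).

Lemma pol_scale n a p : pol n p -> pol n (fun e => a * p e).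
Proof.
elim=> {p} [z|p q _ IHp _ IHq|i p ik _ IH]; first exact: (pol_const n (a * z)).
- have := pol_add IHp IHq; congr pol; apply: funext => e; ring.
- have := pol_mulvar ik IH; congr pol; apply: funext => e; ring.
Qed.

Lemma pol_sum n (k : nat) (p : nat -> env -> rat) :
  (forall j, (j < k)%N -> pol n (p j)) -> pol n (fun e => \sum_(j < k) p j e).
Proof.
elim: k => [|k IH] hp.
  have := pol_const n 0; congr pol; apply: funext => e; by rewrite big_ord0.
have h : pol n (fun e => \sum_(j < k) p j e) by apply: IH => j jk; apply: hp; exact: ltnW.
have := pol_add h (hp k (ltnSn k)); congr pol; apply: funext => e.
by rewrite big_ord_recr.
Qed.

Lemma pol_mul_affine n u p : affine n u -> pol n p ->
  pol n (fun e => (u e)%:~R * p e).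
Proof.
move=> [c [z uE]] hp.
have h j : (j < n)%N -> pol n (fun e => (c j)%:~R * ((e j)%:~R * p e)).
  by move=> jn; apply/pol_scale/pol_mulvar.
have := pol_add (pol_sum h) (pol_scale z%:~R hp); congr pol; apply: funext => e.
rewrite uE rmorphD rmorph_sum mulrDl mulr_suml; congr (_ + _).
by apply: eq_bigr => j _; rewrite rmorphM /= mulrA.
Qed.

Lemma pol_behead n p : pol n p -> pol n.+1 (fun e => p (behead_env e)).
Proof.
elim=> {p} [z|p q _ IHp _ IHq|i p ik _ IH]; first exact: pol_const.
- exact: pol_add.
- exact: (@pol_mulvar n.+1 i.+1).
Qed.

Lemma pol_shift n d p : pol n.+1 p ->
  pol n.+1 (fun e => p (scons (e 0%N + d) (behead_env e))).
Proof.
elim=> {p} [z|p q _ IHp _ IHq|[|i] p ik _ IH]; first exact: pol_const.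
- exact: pol_add.
- apply: (pol_mul_affine _ IH).
  by apply: affine_add; [exact: affine_var|exact: affine_const].
- exact: (@pol_mulvar n.+1 i.+1).
Qed.

(* [p] evaluated at the rational root [x] of [a * x = u e]. *)
Lemma pol_root n p (a : int) u : pol n.+1 p -> a != 0 -> affine n u ->
  exists q, pol n q /\ forall e x, a * x = u e -> p (scons x e) = q e.
Proof.
move=> hp a0 hu; elim: hp => {p} [z|p q _ [p' [hp pE]] _ [q' [hq qE]]|i p ik _ [p' [hp pE]]].
- by exists (fun=> z); split=> //; exact: pol_const.
- exists (fun e => p' e + q' e); split; first exact: pol_add.
  by move=> e x r; rewrite (pE e x) // (qE e x).
- case: i ik => [|i] ik /=; last first.
    exists (fun e => (e i)%:~R * p' e); split; first exact: pol_mulvar.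
    by move=> e x /pE ->.
  exists (fun e => a%:~R^-1 * ((u e)%:~R * p' e)); split.
    by apply/pol_scale/pol_mul_affine.
  move=> e x r; rewrite (pE e x) // -r rmorphM mulrA mulKf //.
  by rewrite intr_eq0.
Qed.

(** Falling factorials [ff] of step [d] are used: the difference of [ff j.+1] is [j.+1 * d] times
    [ff j], so each is integrated by division. *)
Lemma pol_antidifference n p (d : int) : d != 0 -> pol n.+1 p ->
  exists q, pol n.+1 q /\
    forall x e, q (scons (x + d) e) - q (scons x e) = p (scons x e).
Proof.
move=> d0 hp; pose ff j (x : int) : rat := \prod_(i < j) (x - i%:Z * d)%:~R.
have ffS j x : ff j.+1 x = (x - j%:Z * d)%:~R * ff j x.
  by rewrite /ff big_ord_recr /= mulrC.
have ffD j x : ff j.+1 (x + d) = (x + d)%:~R * ff j x.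
  rewrite /ff big_ord_recl mul0r subr0; congr (_ * _); apply: eq_bigr => i _.
  by congr (_%:~R); rewrite /= /bump /= add1n intS; ring.
pose span (p : env -> rat) := exists q, pol n.+1 q /\
  forall x e, q (scons (x + d) e) - q (scons x e) = p (scons x e).
(* Impredicative form of the claim that [p] is a sum of terms [q * ff j] with [q] free of the first
   variable. The freedom in [sp] lets multiplication by a variable be absorbed into it. *)
pose NF := fun p : env -> rat => forall sp : (env -> rat) -> Prop,
  (forall j q, pol n q -> sp (fun e => q (behead_env e) * ff j (e 0%N))) ->
  (forall p q, sp p -> sp q -> sp (fun e => p e + q e)) -> sp p.
have nf_pol : NF p.
  elim: hp => {p} [z|p q _ IHp _ IHq|i p ik _ IH] sp sp1 sp2.
  - have := sp1 0%N _ (pol_const n z); congr sp; apply: funext => e.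
    by rewrite /ff big_ord0 mulr1.
  - by apply: (sp2); [apply: IHp|apply: IHq].
  apply: (IH (fun p => sp (fun e => (e i)%:~R * p e))) => [j q hq|q r hq hr].
    case: i ik => [|i] ik.
      (* Here [x * ff j x = ff j.+1 x + j * d * ff j x]. *)
      have := sp2 _ _ (sp1 j.+1 _ hq) (sp1 j _ (pol_scale (j%:Z * d)%:~R hq)).
      congr sp; apply: funext => e; rewrite ffS rmorphB /=; ring.
    by have := sp1 j _ (pol_mulvar (ik : (i < n)%N) hq); congr sp; apply: funext => e; rewrite mulrA.
  by have := sp2 _ _ hq hr; congr sp; apply: funext => e; rewrite mulrDr.
apply: (nf_pol span) => [j q hq|p1 p2 [q1 [h1 E1]] [q2 [h2 E2]]]; last first.
  exists (fun e => q1 e + q2 e); split; first exact: pol_add.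
  by move=> x e; rewrite -E1 -E2; ring.
have hff : forall i, pol n.+1 (fun e => q (behead_env e) * ff i (e 0%N)).
  elim=> [|i IH].
    by have := pol_behead hq; congr pol; apply: funext => e; rewrite /ff big_ord0 mulr1.
  have ha : affine n.+1 (fun e => e 0%N - i%:Z * d).
    by apply: affine_add; [exact: affine_var|exact: affine_const].
  by have := pol_mul_affine ha IH; congr pol; apply: funext => e; rewrite ffS mulrCA.
exists (fun e => ((j.+1)%:Z * d)%:~R^-1 * (q (behead_env e) * ff j.+1 (e 0%N))).
split; first exact/pol_scale.
move=> x e; rewrite -mulrBr /= -[behead_env (scons _ e)]/e -[behead_env _]/e.
rewrite -mulrBr ffD ffS -mulrBl -rmorphB /=.
have -> : x + d - (x - j%:Z * d) = j.+1%:Z * d by rewrite intS; ring.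
have jd0 : (j.+1%:Z * d)%:~R != 0 :> rat by rewrite intr_eq0 mulf_neq0.
by rewrite mulrCA mulKf.
Qed.

(** * Sums of polynomials restricted to possibly overlapping Presburger sets *)

Inductive pwpol (n : nat) : (env -> rat) -> Prop :=
| pwpol_piece (Q : env -> Prop) p : pres n Q -> pol n p ->
    pwpol n (fun e => if `[<Q e>] then p e else 0)
| pwpol_add f g : pwpol n f -> pwpol n g -> pwpol n (fun e => f e + g e).

Lemma pwpol_const n z : pwpol n (fun=> z).
Proof.
have := pwpol_piece (pres_le (affine_const n 0) (affine_const n 0)) (pol_const n z).
by congr pwpol; apply: funext => e; rewrite asboolT.
Qed.

Lemma pwpol_restrict n (D : env -> Prop) f : pres n D -> pwpol n f ->
  pwpol n (fun e => if `[<D e>] then f e else 0).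
Proof.
move=> hD; elim=> {f} [Q p hQ hp|f g _ IHf _ IHg].
  have := pwpol_piece (pres_and hD hQ) hp; congr pwpol; apply: funext => e.
  by rewrite asbool_and; case: asboolP; case: asboolP.
have := pwpol_add IHf IHg; congr pwpol; apply: funext => e.
by case: asboolP => //; rewrite addr0.
Qed.

Lemma pwpol_opp n f : pwpol n f -> pwpol n (fun e => - f e).
Proof.
elim=> {f} [Q p hQ hp|f g _ IHf _ IHg].
  have := pwpol_piece hQ (pol_scale (-1) hp); congr pwpol; apply: funext => e.
  by case: asboolP; rewrite ?mulN1r ?oppr0.
by have := pwpol_add IHf IHg; congr pwpol; apply: funext => e; rewrite opprD.
Qed.

Lemma pwpol_sum n k (f : nat -> env -> rat) : (forall j, pwpol n (f j)) ->
  pwpol n (fun e => \sum_(j < k) f j e).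
Proof.
move=> hf; elim: k => [|k IH].
  have := pwpol_const n 0; congr pwpol; apply: funext => e; by rewrite big_ord0.
have := pwpol_add IH (hf k); congr pwpol; apply: funext => e.
by rewrite big_ord_recr.
Qed.

Lemma pwpol_subst n u f : affine n u -> pwpol n.+1 f ->
  pwpol n (fun e => f (scons (u e) e)).
Proof.
move=> hu; elim=> {f} [Q p hQ hp|f g _ IHf _ IHg]; last exact: pwpol_add.
have [q [hq qE]] := pol_root hp (oner_neq0 int) hu.
have := pwpol_piece (pres_subst hu hQ) hq; congr pwpol; apply: funext => e.
by rewrite (qE e (u e)) ?mul1r.
Qed.

Definition indic (Q : env -> Prop) (p : env -> rat) (e : env) : rat :=
  if `[<Q e>] then p e else 0.

Lemma pres_lt_abs n u v : affine n u -> affine n v ->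
  pres n (fun e => u e < `|v e|).
Proof.
move=> hu hv; apply: (pres_ext (pres_or (pres_lt hu hv) (pres_lt hu (affine_opp hv)))).
by move=> e; rewrite lter_normr; split=> [[->|->]|/orP] //; rewrite orbT.
Qed.

(** * Summation of a piecewise polynomial over one digit *)

Section Summation.
Variables (n tau : nat) (tau_lt : (tau < n)%N).

Definition sum_digit (f : env -> rat) (e : env) : rat :=
  \sum_(x < `|e tau|) f (scons x%:Z e).

(** [C] will hold the points where summation by parts needs a correction; the extra [D] makes the
    notion stable under unions. *)
Definition summable (C : env -> Prop) := pres n.+1 C /\
  forall D p, pres n.+1 D -> pol n.+1 p ->
    pwpol n (sum_digit (indic (fun e => C e /\ D e) p)).

(** For fixed [e] at most one digit contributes, and [p] at the root of [a * x = u e] is a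
    polynomial in [e]. *)
Lemma summable_graph (a : int) u (C : env -> Prop) :
  a != 0 -> affine n u -> pres n.+1 C ->
  (forall x e, C (scons x e) -> a * x = u e) -> summable C.
Proof.
move=> a0 hu hC graphC; split=> // D p hD hp.
have [q [hq qE]] := pol_root hp a0 hu.
pose X e := exists x, (0 <= x /\ x < `|e tau|) /\ (C (scons x e) /\ D (scons x e)).
have hX : pres n X.
  apply: pres_ex; apply: pres_and.
    apply: pres_and; first by apply: pres_le; [exact: affine_const|exact: affine_var].
    exact: (pres_lt_abs (affine_var (ltn0Sn n)) (affine_var (tau_lt : (tau.+1 < n.+1)%N))).
  by apply: (pres_ext (pres_and hC hD)) => e; rewrite scons_behead.
have := pwpol_piece hX hq; congr pwpol; apply: funext => e; rewrite /sum_digit /indic.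
case: asboolP => [[x [[x0 xt] [Cx Dx]]]|noX].
  have xt' : (`|x| < `|e tau|)%N by lia.
  have xE : `|x|%N%:Z = x by lia.
  rewrite (bigD1 (Ordinal xt')) //= xE asboolT // (qE e x (graphC _ _ Cx)) //.
  rewrite big1 ?addr0 // => y; rewrite -val_eqE /= => yx; case: asboolP => // -[Cy _].
  case/negP: yx; apply/eqP; have := graphC _ _ Cy; rewrite -(graphC _ _ Cx).
  by move/(mulfI a0); lia.
rewrite big1 // => y _; case: asboolP => // -[Cy Dy]; case: noX.
by exists y%:Z; split=> //; split=> //; have := ltn_ord y; lia.
Qed.

Lemma summable_or C C' : summable C -> summable C' -> summable (fun e => C e \/ C' e).
Proof.
move=> [hC sC] [hC' sC']; split=> [|D p hD hp]; first exact: pres_or.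
(* The second sum runs over [C'] minus [C], so that no digit is counted twice. *)
have := pwpol_add (sC D p hD hp) (sC' _ p (pres_and hD (pres_not hC)) hp).
congr pwpol; apply: funext => e; rewrite /sum_digit -big_split; apply: eq_bigr => x _.
rewrite /indic /=; move: (scons _ e) => e'.
do ![case: asboolP] => //; rewrite ?addr0 ?add0r //; tauto.
Qed.

Lemma summable_false : summable (fun=> False).
Proof.
have h : pres n.+1 (fun=> False).
  have h := pres_le (affine_const n.+1 1) (affine_const n.+1 0).
  by apply: (pres_ext h) => e.
split=> // D p hD hp; have := pwpol_const n 0; congr pwpol; apply: funext => e.
by rewrite /sum_digit big1 // => x _; rewrite /indic; case: asboolP => // -[].
Qed.

Lemma summable_ex (I : finType) (C : I -> env -> Prop) :
  (forall i, summable (C i)) -> summable (fun e => exists i, C i e).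
Proof.
move=> hC.
suff h (s : seq I) : summable (fun e => exists i, i \in s /\ C i e).
  have := h (enum I); congr summable; apply: funext => e; apply: propext.
  by split=> [[i [_ Ci]]|[i Ci]]; exists i; rewrite ?mem_enum.
elim: s => [|i s IH].
  have := summable_false; congr summable; apply: funext => e; apply: propext.
  by split=> // -[i []].
have := summable_or (hC i) IH; congr summable; apply: funext => e; apply: propext.
split=> [[Ci|[j [js Cj]]]|[j []]].
- by exists i; rewrite mem_head.
- by exists j; rewrite inE js orbT.
- by rewrite inE => /orP[/eqP->|js Cj]; [left|right; exists j].
Qed.

Definition shift_env (d : int) (e : env) := scons (e 0%N + d) (behead_env e).

Lemma pres_shift d Q : pres n.+1 Q -> pres n.+1 (fun e => Q (shift_env d e)).
Proof.
move=> [I [L [D [B [N h]]]]]; have [D0 B0 {}h] := h N (leqnn N).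
exists I, L, D, (B + \sum_i `|L i 0%N * d|), 0%N => t _; split=> //.
  by apply: addr_ge0 => //; apply: sumr_ge0.
move=> e e' [s1 s2]; apply: h; split=> [[_|l ln]|i].
- by have [q qE] := s1 0%N isT; exists q; rewrite /shift_env /= qE; ring.
- exact: (s1 l.+1).
have lE w : lform evZ n.+1 N (L i) (shift_env d w) = L i 0%N * d + lform evZ n.+1 N (L i) w.
  by rewrite -{2}(scons_behead w) !lform_scons /=; ring.
rewrite !lE; apply/near_eq_shift/near_eqW/s2.
by rewrite lerD2l (bigD1 i) //= lerDl sumr_ge0.
Qed.

(* A Presburger set is periodic away from finitely many graphs: the truth value
   can only change between [x] and [x + d] near the zeros of the linear forms. *)
Lemma pres_change Q : pres n.+1 Q -> exists d : nat, (0 < d)%N /\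
  exists C, summable C /\ forall e, ~ (Q (shift_env d%:Z e) <-> Q e) -> C e.
Proof.
move=> [I [L [D [B [N h]]]]]; have [D0 B0 {}h] := h N (leqnn N).
have {}D0 : 0 < D := D0; have {}B0 : 0 <= B := B0.
exists `|D|%N; split; first by lia.
(* A step of length [|D|] changes a form by at most [K - B], so a form beyond [K] stays beyond [B]
   on the same side. *)
pose K : int := B + `|D| * \sum_i `|L i 0%N|.
have K0 : 0 <= K by rewrite addr_ge0 // mulr_ge0 // sumr_ge0.
pose Lt i e := lform evZ n N (fun j => L i j.+1) e.
(* One graph for each form that involves [x] and each value [s - K] in [[-K, K]]. *)
pose C (ij : I * 'I_((absz K).*2.+1)) e :=
  L ij.1 0%N != 0 /\ L ij.1 0%N * e 0%N + Lt ij.1 (behead_env e) = ij.2%:Z - K.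
have hLt i : affine n (Lt i).
  by exists (fun j => L i j.+1), 0 => e; rewrite addr0.
exists (fun e => exists ij, C ij e); split.
  apply: summable_ex => -[i s]; have [Li0|Li0] := eqVneq (L i 0%N) 0.
    have := summable_false; congr summable; apply: funext => e; apply: propext.
    by rewrite /C Li0 eqxx; split=> // -[].
  apply: (summable_graph Li0 (affine_add (affine_const n (s%:Z - K)) (affine_opp (hLt i)))).
    have h1 := affine_add (affine_scale (L i 0%N) (affine_var (ltn0Sn n))) (affine_behead (hLt i)).
    apply: (pres_ext (pres_eq h1 (affine_const _ (s%:Z - K)))) => e.
    by rewrite /C Li0 /=; split=> [|[]].
  by move=> x e [_ /= <-]; rewrite -[behead_env _]/e; ring.
move=> e change; apply: contrapT => noC; apply: change.
suff sm : sim evZ n.+1 N L (evZ N D) (evZ N B) (shift_env `|D|%N e) e.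
  by split; apply: h => //; exact: sim_sym.
have DE : `|D|%N%:Z = D by rewrite abszE; apply: gtr0_norm.
rewrite DE; split=> [[_|l _]|i].
- by exists 1; rewrite /shift_env /= mul1r.
- by exists 0; rewrite /shift_env /= mul0r addr0.
have lE w : lform evZ n.+1 N (L i) (shift_env D w) = L i 0%N * D + lform evZ n.+1 N (L i) w.
  by rewrite -{2}(scons_behead w) !lform_scons /=; ring.
rewrite lE; have [Li0|Li0] := eqVneq (L i 0%N) 0.
  by rewrite Li0 mul0r add0r; constructor 1.
have KL : B + `|L i 0%N * D| <= K.
  rewrite /K normrM lerD2l mulrC ler_wpM2l // (bigD1 i) //= lerDl sumr_ge0 //.
have : K < `|lform evZ n.+1 N (L i) e|.
  rewrite ltNge; apply/negP => le; apply: noC.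
  have aux (w : int) : `|w| <= K -> (absz (w + K)%R < (absz K).*2.+1)%N.
    by move: (K) K0 => k k0; lia.
  have sK := aux _ le.
  exists (i, Ordinal sK); split=> //=.
  rewrite /Lt -[_ + lform _ _ _ _ _](@lform_scons _ evZ n N (L i)) scons_behead.
  lia.
move: (lform _ _ _ _ _) (L i 0%N * D) KL => w v; rewrite /evZ /= => KL Kw.
have [w0|w0] := leP 0 w; [constructor 2|constructor 3]; lia.
Qed.

Lemma telescope_shift (f : nat -> rat) (d T : nat) :
  \sum_(x < T) (f (x + d)%N - f x) = \sum_(i < d) f (T + i)%N - \sum_(i < d) f i.
Proof.
elim: T => [|T IH]; first by rewrite big_ord0 subrr.
rewrite big_ord_recr IH /= addrAC; congr (_ - _).
case: d {IH} => [|d]; first by rewrite !big_ord0 addn0 subrr addr0.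
rewrite [X in X + _]big_ord_recl [in RHS]big_ord_recr /= addn0 addSnnS.
rewrite [X in f T + X](_ : _ = \sum_(i < d) f (T.+1 + i)%N); first by ring.
by apply: eq_bigr => i _; rewrite addSnnS.
Qed.

(** The boundary terms of the sum sit at the absolute value of the parameter, which is affine on
    each side of zero. *)
Lemma pwpol_subst_abs f (i : nat) : pwpol n.+1 f ->
  pwpol n (fun e => f (scons (`|e tau| + i%:Z) e)).
Proof.
move=> hf; have ht := affine_var tau_lt.
have h0 := pres_le (affine_const n 0) ht.
have hp := pwpol_restrict h0 (pwpol_subst (affine_add ht (affine_const n i%:Z)) hf).
have hm := pwpol_restrict (pres_not h0)
  (pwpol_subst (affine_add (affine_opp ht) (affine_const n i%:Z)) hf).
have := pwpol_add hp hm; congr pwpol; apply: funext => e.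
rewrite asbool_neg; case: asboolP => /= h; rewrite ?addr0 ?add0r.
  by rewrite ger0_norm.
by rewrite ltr0_norm // ltNge; apply/negP.
Qed.

(* Summation by parts with step [d]. *)
Lemma pwpol_sum_digit f : pwpol n.+1 f -> pwpol n (sum_digit f).
Proof.
elim=> {f} [Q p hQ hp|f g _ IHf _ IHg]; last first.
  by have := pwpol_add IHf IHg; congr pwpol; apply: funext => e; rewrite -big_split.
have [d [d0 [C [[_ sC] changeC]]]] := pres_change hQ.
have [q [hq qE]] : exists q, pol n.+1 q /\ forall x e,
    q (scons (x + d%:Z) e) - q (scons x e) = p (scons x e).
  by apply: pol_antidifference hp; lia.
have hQs := pres_shift d%:Z hQ.
have hqs : pol n.+1 (fun e => q (shift_env d%:Z e)) := pol_shift d%:Z hq.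
(* Let [F] be [q] restricted to [Q]. The sum of [F (x + d) - F x] telescopes to the boundary terms
   [h1] and [h2]. It differs from the wanted sum only where [Q] changes between [x] and [x + d]:
   [h4] adds [q (x + d)] where [Q] is lost, and [h3] removes it where [Q] is gained. *)
have hf := pwpol_piece hQ hq.
have h1 := @pwpol_sum n d _ (fun i => pwpol_subst_abs i hf).
have h2 := @pwpol_sum n d _ (fun i => pwpol_subst (affine_const n i%:Z) hf).
have h3 := sC _ _ (pres_and hQs (pres_not hQ)) hqs.
have h4 := sC _ _ (pres_and hQ (pres_not hQs)) hqs.
have := pwpol_add (pwpol_add h1 (pwpol_opp h2)) (pwpol_add h4 (pwpol_opp h3)).
congr pwpol; apply: funext => e.
pose F (x : nat) := indic Q q (scons x%:Z e).
have -> : \sum_(j < d) (if `[<Q (scons (`|e tau| + j%:Z) e)>] then q (scons (`|e tau| + j%:Z) e) else 0)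
  = \sum_(j < d) F (`|e tau| + j)%N.
  by apply: eq_bigr => j _; rewrite /F /indic PoszD abszE.
rewrite -[X in _ - X + _]/(\sum_(j < d) F j) -telescope_shift.
rewrite /sum_digit -sumrB -big_split; apply: eq_bigr => x _ /=.
rewrite /F /indic -qE PoszD.
have sE : shift_env d%:Z (scons x%:Z e) = scons (x%:Z + d%:Z) e by [].
have := changeC (scons x%:Z e); rewrite sE => ch.
by do ![case: asboolP => ?]; (ring || (exfalso; tauto)).
Qed.

End Summation.

(** * Quasi-polynomials *)

Definition env0 : env := fun=> 0.
Definition tenv (t : nat) : env := fun=> t%:Z.

Lemma periodic_add (Q : nat -> Prop) N d :
  (forall n, (N <= n)%N -> (Q n <-> Q (n + d)%N)) ->
  forall j n, (N <= n)%N -> (Q n <-> Q (n + j * d)%N).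
Proof.
move=> h j n Nn; elim: j => [|j IH]; first by rewrite mul0n addn0.
by rewrite IH h ?mulSn ?addnA 1?[(n + d + _)%N]addnAC //; lia.
Qed.

(** For large [n] every form with a nonzero coefficient is beyond the truncation bound, on a side
    fixed by its sign, so only the residue of [n] matters. *)
Lemma pres_periodic Q : pres 1 Q ->
  exists N d, (0 < d)%N /\ forall n, (N <= n)%N -> (Q (tenv n) <-> Q (tenv (n + d)%N)).
Proof.
move=> [I [L [D [B [N h]]]]]; have [D0 B0 {}h] := h N (leqnn N).
have {}D0 : 0 < D := D0; have {}B0 : 0 <= B := B0.
exists (absz B).+1, (absz D); split=> [|n Bn]; first by lia.
suff s : sim evZ 1 N L (evZ N D) (evZ N B) (tenv n) (tenv (n + absz D)%N).
  by split; apply: h => //; exact: sim_sym.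
split=> [i _|i]; first by exists (-1); rewrite /tenv /evZ /=; lia.
rewrite /lform !big_ord1 /evZ /tenv /=; move: (L i 0%N) => c.
have [->|c0] := eqVneq c 0; first by rewrite !mul0r; constructor 1.
have cE : (n + absz D)%N%:Z = n%:Z + D by lia.
rewrite cE; have : B < n%:Z by lia.
move: (n%:Z) => x Bx; have [c1|c1] := leP 0 c; [constructor 2|constructor 3]; split; nia.
Qed.

Definition eqpoly (F : nat -> rat) := exists (N p : nat) (q : nat -> {poly rat}),
  (0 < p)%N /\ forall n, (N <= n)%N -> F n = (q (n %% p)%N).[n%:R].

Lemma eqpoly_add F G : eqpoly F -> eqpoly G -> eqpoly (fun n => F n + G n).
Proof.
move=> [N [p [q [p0 FE]]]] [N' [p' [q' [p'0 GE]]]].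
exists (maxn N N'), (p * p')%N, (fun r => q (r %% p)%N + q' (r %% p')%N).
split=> [|n]; first by rewrite muln_gt0 p0.
rewrite geq_max => /andP[/FE -> /GE ->]; rewrite hornerD.
by rewrite (modn_dvdm n (dvdn_mulr p' (dvdnn p))) (modn_dvdm n (dvdn_mull p (dvdnn p'))).
Qed.

Lemma pol_poly p : pol 1 p -> exists P : {poly rat}, forall t, p (tenv t) = P.[t%:R].
Proof.
elim=> {p} [z|p q _ [P PE] _ [Q QE]|i p _ _ [P PE]].
- by exists z%:P => t; rewrite hornerC.
- by exists (P + Q) => t; rewrite hornerD PE QE.
- by exists (P * 'X) => t; rewrite hornerMX PE mulrC.
Qed.

Lemma pwpol_eqpoly f : pwpol 1 f -> eqpoly (fun t => f (tenv t)).
Proof.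
elim=> {f} [Q p hQ hp|f g _ IHf _ IHg]; last exact: eqpoly_add.
have [N [d [d0 per]]] := pres_periodic hQ; have [P PE] := pol_poly hp.
exists N, d, (fun r => if `[<Q (tenv (r + N * d)%N)>] then P else 0); split=> // n Nn.
have perQ := periodic_add per.
have /asbool_equiv_eq -> : Q (tenv (n %% d + N * d)%N) <-> Q (tenv n).
  rewrite (perQ N n Nn) (perQ (n %/ d)%N (n %% d + N * d)%N); last by nia.
  by have -> : (n %% d + N * d + n %/ d * d = n + N * d)%N by rewrite {3}(divn_eq n d); lia.
by case: asboolP => _; rewrite ?PE ?horner0.
Qed.

(** If all constituents [q r] vanish, [g] is eventually zero. Otherwise the degree is the largest
    degree of a constituent, and the leading coefficient is nonzero along a whole residue class. *)
Lemma eqpoly_eqp F (g : nat -> int) N0 : eqpoly F ->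
  (forall n, (N0 <= n)%N -> (g n)%:~R = F n) -> Defs.eqp g.
Proof.
move=> [N1 [p [q [p0 FE]]]] gF; pose N := maxn N0 N1.
have gE n : (N <= n)%N -> (g n)%:~R = (q (n %% p)%N).[n%:R].
  by rewrite geq_max => /andP[/gF -> /FE].
have [q0|q_neq0] := pselect (forall r, (r < p)%N -> q r = 0).
  right; exists N => n /gE; rewrite q0 ?ltn_mod // horner0 => /eqP.
  by rewrite intr_eq0 => /eqP.
left; pose s := (\max_(r < p) size (q r))%N.
have [r0 sr0] : exists r0 : 'I_p, size (q r0) = s.
  have [|r rs] := @bigop.eq_bigmax _ (fun r : 'I_p => size (q r)); first by rewrite card_ord.
  by exists r.
have s0 : (0 < s)%N.
  have [r [rp qr]] : exists r, (r < p)%N /\ q r != 0.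
    apply: contrapT => h; apply: q_neq0 => r rp; apply: contrapT => /eqP qr.
    by apply: h; exists r.
  apply: leq_trans (leq_bigmax (Ordinal rp)) => /=.
  by rewrite lt0n size_poly_eq0.
exists s.-1; have sS : s = s.-1.+1 by rewrite prednK.
(* Below [N] the constant coefficient takes the value [g n] itself, so that the formula holds for
   every [n]. *)
exists (fun (j : 'I_s.-1.+1) n => if (n < N)%N then (if val j == 0%N then (g n)%:~R else 0)
  else (q (n %% p)%N)`_j); split.
- move=> j; exists N, p; split=> // n Nn.
  by rewrite !ltnNge (leq_trans Nn (leq_addr _ _)) Nn /= modnDr.
- move=> n; case: ltnP => [nN|Nn].
    rewrite big_ord_recl /= expr0 mulr1 big1 ?addr0 // => i _.
    by rewrite mul0r.
  rewrite gE // (horner_coef_wide (n := s)); first by rewrite sS.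
  by have := leq_bigmax (Ordinal (ltn_pmod n p0)) => /(_ (fun r : 'I_p => size (q r))).
- move=> fin; have [X XE] := (iffLR finite_fsetP) fin.
  (* [n] is congruent to [r0] and lies beyond [N] and all of [X]; its top coefficient is the leading
     coefficient of [q r0]. *)
  pose M := (\max_(x <- X) x)%N.
  pose n := (r0 + (N + M).+1 * p)%N.
  have nM : (M < n)%N by rewrite /n; nia.
  have nN : (N <= n)%N by rewrite /n; nia.
  suff : [set` X] n.
    move=> /= nX; move: nM; rewrite ltnNge /M.
    by rewrite (big_rem n) //= leq_maxl.
  rewrite -XE /= ltnNge nN /= /n addnC modnMDl modn_small ?ltn_ord //.
  by rewrite -sr0 -lead_coefE lead_coef_eq0 -size_poly_eq0 sr0 -lt0n.
Qed.

(** * The two transfer principles *)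

Lemma ppa_periodic P : ppa 0 P -> eventually_periodic_set [set t | P t env0].
Proof.
move=> /ppa_box_pres /(_ 1%N 0%N (fun _ _ => 0) isT) [|Q [N [hQ PQ]]].
  by move=> _; apply/tpoly_affine/affine_const.
have [N' [d [d0 per]]] := pres_periodic hQ.
have PE t : (N <= t)%N -> P t env0 <-> Q (tenv t).
  by move=> Nt; rewrite -PQ // /tenv; split=> [|i _] /=; lia.
exists (maxn N N'), d; split=> // n; rewrite geq_max => /andP[Nn N'n] /=.
by rewrite PE // per // -PE //; lia.
Qed.

Lemma int_set_count (A : set int) (b : int) (T m : nat) : (A #= `I_m)%card ->
  (forall x, A x -> - b <= x < T%:Z - b) ->
  (\sum_(x < T) `[<A (x%:Z - b)%R>])%N = m.
Proof.
move=> Am bA; have /finite_fsetP [X XE] : finite_set A by exists m.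
move: Am; rewrite XE => /card_eq_fsetP <-.
pose s := [seq x%:Z - b | x <- iota 0 T & `[<A (x%:Z - b)>]].
have sX : perm_eq X s.
  apply: uniq_perm; first exact: fset_uniq.
    by rewrite map_inj_uniq ?filter_uniq ?iota_uniq // => x y /addIr [].
  move=> x; apply/idP/mapP => [xX|[y]].
    have Ax : A x by rewrite XE.
    have xE : (absz (x + b))%:Z - b = x by have := bA x Ax; lia.
    exists (absz (x + b)) => //; rewrite mem_filter mem_iota xE asboolT //=.
    by have := bA x Ax; lia.
  by rewrite mem_filter => /andP[/asboolP Ay _] ->; rewrite XE in Ay.
rewrite (perm_size sX) size_map size_filter -sum1_count.
rewrite -XE -(big_mkord xpredT (fun x => nat_of_bool `[<A (x%:Z - b)%R>])).
by rewrite [RHS]big_mkcond /index_iota subn0; apply: eq_bigr => x _; case: asboolP.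
Qed.

(** Each summation removes index 0, so the parameter moves from index [r] down to index 0. *)
Fixpoint iter_sum_digit (r : nat) (f : env -> rat) : env -> rat :=
  if r is r'.+1 then iter_sum_digit r' (sum_digit r' f) else f.

Lemma pwpol_iter_sum_digit r f : pwpol r.+1 f -> pwpol 1 (iter_sum_digit r f).
Proof. by elim: r f => [|r IH] f //= hf; apply/IH/pwpol_sum_digit. Qed.

Lemma sum_base (t M : nat) (h : nat -> rat) :
  \sum_(y < M) \sum_(x < t) h (x + t * y)%N = \sum_(x < t * M) h x.
Proof.
elim: M => [|M IH]; first by rewrite muln0 !big_ord0.
rewrite big_ord_recr IH /= mulnS addnC -!(big_mkord xpredT).
rewrite [RHS](big_cat_nat (n := t * M)) ?leq_addr //=; congr (_ + _).
by rewrite -[in RHS](add0n (t * M)%N) big_addn add0n addKn big_mkord.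
Qed.

(** Base [t] expansion matches strings of [r] digits in [[0, t)] with the numbers below [t ^ r]. *)
Lemma iter_sum_digitE r (t : nat) f (h : int -> rat) :
  (forall e, (forall i, (i < r)%N -> 0 <= e i < t%:Z) -> e r = t%:Z ->
    f e = h (\sum_(i < r) e i * t%:Z ^+ i)) ->
  forall e, e 0%N = t%:Z ->
  iter_sum_digit r f e = \sum_(x < t ^ r) h x%:Z.
Proof.
elim: r f h => [|r IH] f h fE e et.
  by rewrite /= fE // big_ord0 expn0 big_ord1.
rewrite /= (IH _ (fun y => \sum_(x < t) h (x%:Z + t%:Z * y))) //.
  rewrite expnS -(sum_base t (t ^ r) (fun x => h x%:Z)); apply: eq_bigr => y _.
  by apply: eq_bigr => x _; rewrite PoszD PoszM.
move=> e' e'b e't; rewrite /sum_digit e't absz_nat; apply: eq_bigr => x _.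
rewrite fE //; last by case=> [|i] /= ir; [have := ltn_ord x; lia|exact: e'b].
congr h; rewrite big_ord_recl expr0 mulr1 /=; congr (_ + _); rewrite mulr_sumr.
by apply: eq_bigr => i _; rewrite exprS mulrCA.
Qed.

(** * Parametric linear terms and the formulas built from them *)

Definition plin (k : nat) (u : nat -> env -> int) :=
  exists (c : nat -> {poly int}) (b : {poly int}),
    forall t e, u t e = lform evP k t c e + evP t b.

Lemma plin_ext k u v : (forall t e, u t e = v t e) -> plin k u -> plin k v.
Proof. by move=> h [c [b uE]]; exists c, b => t e; rewrite -h. Qed.

Lemma plin_poly k (p : {poly int}) : plin k (fun t _ => p.[t%:Z]).
Proof.
exists (fun=> 0), p => t e; rewrite /lform big1 ?add0r // => i _.
by rewrite rmorph0 mul0r.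
Qed.

Lemma plin_const k (z : int) : plin k (fun _ _ => z).
Proof. by have := plin_poly k z%:P; apply: plin_ext => t e; rewrite hornerC. Qed.

Lemma plin_var k i : (i < k)%N -> plin k (fun _ e => e i).
Proof.
move=> ik; exists (fun j => (j == i)%:R), 0 => t e; rewrite rmorph0 addr0.
rewrite /lform (bigD1 (Ordinal ik)) //= eqxx rmorph1 mul1r big1 ?addr0 // => j.
by rewrite -val_eqE /= => /negbTE ->; rewrite rmorph0 mul0r.
Qed.

Lemma plin_add k u v : plin k u -> plin k v -> plin k (fun t e => u t e + v t e).
Proof.
move=> [c [b uE]] [d [b' vE]]; exists (fun i => c i + d i), (b + b') => t e.
by rewrite uE vE lformD rmorphD addrACA.
Qed.

Lemma plin_polymul k (p : {poly int}) u : plin k u ->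
  plin k (fun t e => p.[t%:Z] * u t e).
Proof.
move=> [c [b uE]]; exists (fun i => p * c i), (p * b) => t e.
by rewrite uE lformZ rmorphM -mulrDr.
Qed.

Lemma plin_scale k (a : int) u : plin k u -> plin k (fun t e => a * u t e).
Proof. by move=> /(plin_polymul a%:P); apply: plin_ext => t e; rewrite hornerC. Qed.

Lemma plin_opp k u : plin k u -> plin k (fun t e => - u t e).
Proof. by move=> /(plin_scale (-1)); apply: plin_ext => t e; rewrite mulN1r. Qed.

Lemma plin_behead k u : plin k u -> plin k.+1 (fun t e => u t (behead_env e)).
Proof.
move=> [c [b uE]]; exists (fun i => if i is j.+1 then c j else 0), b => t e.
by rewrite uE -{2}(scons_behead e) lform_scons rmorph0 mul0r add0r.
Qed.

Lemma ppa_ext k P Q : (forall t e, P t e <-> Q t e) -> ppa k P -> ppa k Q.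
Proof.
move=> PQ; rewrite (_ : P = Q) //.
by apply/funext => t; apply/funext => e; apply/propext.
Qed.

Lemma ppa_le k u v : plin k u -> plin k v -> ppa k (fun t e => u t e <= v t e).
Proof.
move=> hu hv; have [c [b uvE]] := plin_add hu (plin_opp hv).
by apply: ppa_ext (ppa_lform k c b) => t e; rewrite -uvE subr_le0.
Qed.

Lemma ppa_lt k u v : plin k u -> plin k v -> ppa k (fun t e => u t e < v t e).
Proof.
move=> hu hv; apply: ppa_ext (ppa_le (plin_add hu (plin_const k 1)) hv) => t e.
by rewrite lezD1.
Qed.

Lemma ppa_eq k u v : plin k u -> plin k v -> ppa k (fun t e => u t e = v t e).
Proof.
move=> hu hv; apply: ppa_ext (ppa_and (ppa_le hu hv) (ppa_le hv hu)) => t e.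
by split=> [[h1 h2]|->] //; apply/eqP; rewrite eq_le h1.
Qed.

Lemma ppa_imp k P Q : ppa k P -> ppa k Q -> ppa k (fun t e => P t e -> Q t e).
Proof.
move=> hP hQ; apply: ppa_ext (ppa_not (ppa_and hP (ppa_not hQ))) => t e.
by split=> [h p|h [p nq]]; [apply: contrapT => nq; apply: h|exact/nq/h].
Qed.

Lemma ppa_ex k (P : nat -> env -> int -> Prop) :
  ppa k.+1 (fun t e => P t (behead_env e) (e 0%N)) ->
  ppa k (fun t e => exists x, P t e x).
Proof. exact: ppa_ex_env. Qed.

Lemma ppa_all k (P : nat -> env -> int -> Prop) :
  ppa k.+1 (fun t e => P t (behead_env e) (e 0%N)) ->
  ppa k (fun t e => forall x, P t e x).
Proof.
move=> hP; apply: ppa_ext (ppa_not (ppa_ex (P := fun t e x => ~ P t e x) (ppa_not hP))).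
by move=> t e; rewrite -forallNP; split=> h x; [apply: contrapT; apply: h|move=> /(_ (h x))].
Qed.

Lemma ppa_bounded (A : nat -> int -> Prop) :
  (forall k u, plin k u -> ppa k (fun t e => A t (u t e))) ->
  ppa 0 (fun t _ => exists b : int, forall x, A t x -> `|x| <= b).
Proof.
move=> hA; apply: ppa_ex; apply: ppa_all; apply: ppa_imp.
  by apply/hA/plin_var.
have h0 := plin_var (isT : (0 < 2)%N); have h1 := plin_var (isT : (1 < 2)%N).
apply: ppa_ext (ppa_and (ppa_le (plin_opp h1) h0) (ppa_le h0 h1)) => t e.
by rewrite ler_norml; split=> [[-> ->]|/andP].
Qed.

(* Beyond the bound [B] of the game the family is invariant under translation
   by [D], away from [0]. *)
Lemma ppa_finite_bound P : ppa 1 P -> exists (B : {poly int}) (N : nat),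
  forall t, (N <= t)%N -> 0 <= B.[t%:Z] /\
    forall b, (forall x, P t (scons x env0) -> `|x| <= b) ->
    forall x, P t (scons x env0) -> `|x| <= B.[t%:Z].
Proof.
move=> /ppa_sim_invariant [I [L [D [B [N H]]]]].
have [N1 HN1] := ev_neq0_fin evP_neq0 (fun i => L i 0%N).
exists B, (maxn N N1) => t; rewrite geq_max => /andP[Nt N1t].
have [D0 B0 h] := H t Nt; split=> // b bP x Px.
(* An element beyond [B] can be moved away from 0 by [|b| + 1] multiples of [D], hence past any
   bound [b]. *)
rewrite leNgt; apply/negP => Bx; pose s : int := if 0 <= x then 1 else -1.
suff Py : P t (scons (x + s * (`|b| + 1) * evP t D) env0).
  have := bP _ Py; move: D0 Bx B0 bP Px; rewrite /s /evP /= /horner_eval.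
  move: D.[_] B.[_] => d B' d0 Bx B0 _ _; case: ifP => x0; nia.
apply: h Px; split=> [[|//] _|i] /=; first by exists (- (s * (`|b| + 1))); ring.
rewrite /lform !big_ord1 /=.
have [->|/(HN1 t i N1t)] := eqVneq (L i 0%N) 0; first by rewrite rmorph0 !mul0r; constructor 1.
move=> a0; have {}a0 : (L i 0%N).[t%:Z] != 0 := a0.
move: D0 Bx B0; rewrite /s /evP /= /horner_eval.
move: D.[_] B.[_] (L i 0%N).[_] a0 => d B' a a0 d0 Bx B0.
have y0 : 0 <= (`|b| + 1) * d by nia.
rewrite -mulrA; move: (_ * d) y0 => y y0.
have pos (u v z : int) : B' < v -> 0 < u -> 0 <= z -> B' < u * (v + z) by nia.
rewrite -[a * x]/(a * x) -{1}[x]addr0; case: ifP => x0; have [a1|a1] := leP 0 a.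
- by constructor 2; split; rewrite ?mul1r; apply: pos; lia.
- by constructor 3; split; rewrite ltrNr -mulNr ?mul1r; apply: pos; lia.
- by constructor 3; split; rewrite ltrNr -mulrN opprD ?mulN1r ?opprK ?oppr0; apply: pos; lia.
- by constructor 2; split; rewrite -mulrNN opprD ?mulN1r ?opprK ?oppr0; apply: pos; lia.
Qed.

(** A finite [A t] lies in [[-B, B]] with [B] polynomial in [t]. Shifted by [B], its elements have
    [r] nonnegative digits, and the indicator function is summed digit by digit. *)
Lemma ppa_card (A : nat -> int -> Prop) :
  (forall k u, plin k u -> ppa k (fun t e => A t (u t e))) ->
  exists g : nat -> int, Defs.eqp g /\
    forall t m, (A t #= `I_m)%card -> g t = m%:Z.
Proof.
move=> hA; have hP := hA 1%N _ (plin_var (ltnSn 0)).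
have [B [N0 HB]] := ppa_finite_bound hP.
pose bd t := exists b : int, forall x, A t x -> `|x| <= b.
(* Enough digits for the [2 * B + 1] integers of [[-B, B]]. *)
have [r [N1 rB]] : pol_bounded 1 0 (fun e => B.[e 0%N] *+ 2 + 1).
  apply: pol_bounded_add (pol_bounded_const _ _ _).
  have := pol_bounded_mul (pol_bounded_const 1 0 2) (pol_bounded_poly B (ltnSn 0)).
  by congr pol_bounded; apply: funext => e; rewrite mulrC mulr_natr.
pose w (e : env) := (\sum_(i < r) e i * e r ^+ i) - B.[e r].
have hw : tpoly r.+1 r w.
  have hB := tpoly_poly (- B) (tpoly_affine r (affine_const r.+1 1)).
  have hd : tpoly r.+1 r (fun e => \sum_(i < r) ('X^i).[e r] * e i).
    apply: (@tpoly_sum _ _ _ (fun i e => ('X^i).[e r] * e i)) => i ir.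
    by apply/tpoly_poly/tpoly_affine/affine_var/ltnW.
  have := tpoly_add hd hB; congr tpoly; apply: funext => e.
  rewrite /w hornerN mulr1; congr (_ - _); apply: eq_bigr => i _.
  by rewrite hornerXn mulrC.
have h1 := ppa_box_pres hP (ltnSn r) (v := fun _ => w) (fun _ => hw).
(* With this conjunct the count is 0 whenever [A t] is unbounded. *)
have h2 := ppa_box_pres (ppa_bounded hA) (ltnSn r) (v := fun _ _ => 0)
  (fun _ => tpoly_affine r (affine_const r.+1 0)).
have [Q [N2 [hQ PQ]]] := box_pres_and h1 h2.
pose F := iter_sum_digit r (fun e => if `[<Q e>] then 1 else 0).
have hF : eqpoly (fun t => F (tenv t)).
  by apply/pwpol_eqpoly/pwpol_iter_sum_digit; exact: (pwpol_piece hQ (pol_const _ 1)).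
pose N := maxn N0 (maxn N1 N2).
pose c t := (\sum_(x < t ^ r) `[<A t (x%:Z - B.[t%:Z])%R /\ bd t>])%N.
(* Below [N] the cardinality is entered by hand, with value 0 for an infinite set. *)
pose g t : int := if (t < N)%N then #|` fset_set (A t : set int)|%fset%:Z else (c t)%:Z.
exists g; split.
  apply: (eqpoly_eqp (N0 := N) hF) => t Nt; rewrite /g ltnNge Nt /=.
  move: Nt; rewrite !geq_max => /and3P[_ _ N2t].
  rewrite /F (@iter_sum_digitE r t _
    (fun y => if `[<A t (y - B.[t%:Z]) /\ bd t>] then 1 else 0)) //.
    rewrite /c -[LHS]/((_%:R) : rat) natr_sum; apply: eq_bigr => x _.
    by case: asboolP.
  move=> e eb er; have eE : in_box N2 r.+1 r e.
    rewrite /in_box er; split=> [|i]; first by lia.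
    rewrite ltnS leq_eqVlt => /orP[/eqP->|/eb]; last by lia.
    by rewrite er; lia.
  rewrite -(asbool_equiv_eq (PQ e eE)) er absz_nat /w er.
  by [].
move=> t m Am; rewrite /g; case: ltnP => [_|Nt]; first by rewrite (card_fset_set Am).
move: Nt; rewrite !geq_max => /and3P[N0t N1t _]; have [B0 AB] := HB t N0t.
have [b bA] : bd t.
  have /finite_fsetP [X XE] : finite_set (A t : set int) by exists m.
  exists (\sum_(x <- X) `|x|) => x; rewrite -[A t x]/((A t : set int) x) XE => xX.
  by rewrite (big_rem x) //= lerDl sumr_ge0.
have bdt : bd t by exists b.
congr Posz; rewrite -(@int_set_count (A t) B.[t%:Z] (t ^ r)%N m Am) => [|x Ax].
  apply: eq_bigr => x _; congr nat_of_bool; apply: asbool_equiv_eq.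
  by split=> [[]|].
have := AB b bA x Ax; have := rB (tenv t); rewrite /tenv /= => rBt xB.
have : `|B.[t%:Z] *+ 2 + 1| <= t%:Z ^+ r by apply: rBt; split=> //=; lia.
have -> : t%:Z ^+ r = (t ^ r)%N%:Z by rewrite -[t%:Z]natz -natrX natz.
rewrite mulr2n; move: (t ^ r)%N => s; lia.
Qed.

(** * Definable sets and quantities *)

(** Quantifying over all arities and all linear terms builds substitution into the notion. *)
Definition definable (A : nat -> int -> Prop) :=
  forall k u, plin k u -> ppa k (fun t e => A t (u t e)).

Lemma setZP (S : set nat) (x : nat) : setZ S x%:Z <-> S x.
Proof. by split=> [[y Sy [<-]]|Sx]; [|exists x]. Qed.

Lemma definable_eqp_cardZ (A : nat -> set int) : definable A -> eqp_card A.
Proof.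
move=> /ppa_card [g [hg gA]]; exists g => // n /finite_setP [m Am].
by rewrite (gA _ _ Am) (card_fset_set Am).
Qed.

Lemma definable_eqp_card (A : nat -> set nat) :
  definable (fun t => setZ (A t)) -> eqp_card A.
Proof.
move=> /ppa_card [g [hg gA]]; exists g => // n /finite_setP [m Am].
rewrite (gA n m) ?(card_fset_set Am) //.
by apply: card_eq_trans Am; apply: inj_card_eq => x y _ _ [].
Qed.

Lemma definable_eqp_where_defined (Q : nat -> nat -> Prop) (R : nat -> int -> Prop) :
  (forall n x, Q n x -> R n x%:Z) ->
  (forall n x y, R n x -> R n y -> x = y) ->
  definable R -> eqp_where_defined Q.
Proof.
move=> QR uniqR hR; pose B t y := exists x, R t x /\ (0 <= y /\ y < x).
have /ppa_card [g [hg gB]] : definable B.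
  move=> k u hu; apply: ppa_ex; apply: ppa_and; first exact/hR/plin_var.
  by apply: ppa_and; [apply: ppa_le|apply: ppa_lt];
    [exact: plin_const|exact: plin_behead|exact: plin_behead|exact: plin_var].
exists g => // n x Qx; apply: gB.
suff -> : (B n : set int) = Posz @` `I_x by apply: inj_card_eq => y z _ _ [].
apply/seteqP; split=> [y [z [Rz [y0 yz]]]|_ [y yx <-]] /=.
  have zx := uniqR _ _ _ Rz (QR _ _ Qx).
  by exists (absz y); rewrite /=; lia.
by exists x%:Z; split; [exact: QR|split; [|move: yx => /=; lia]].
Qed.

(** * Semigroups *)

Lemma finite_complP (S : set nat) :
  finite_set (~` S) <-> exists b, forall x : int, b <= x -> setZ S x.
Proof.
split=> [/finite_fsetP [X XE]|[b bS]].
  exists (\max_(y <- X) y).+1%:Z => x bx.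
  have -> : x = (absz x)%:Z by lia.
  apply/setZP; apply: contrapT => nS; have : [set` X] (absz x) by rewrite -XE.
  move=> /= xX; move: bx; rewrite (big_rem (absz x)) //=; lia.
apply: (@sub_finite_set _ _ `I_(absz b)); last exact: finite_II.
move=> x /= nS; rewrite ltnNge; apply/negP => bx; apply: nS.
by apply/setZP/bS; lia.
Qed.

(** The gaps whose adjunction to a numerical semigroup gives a numerical semigroup again. *)
Definition special_gap (S : set nat) (x : int) : Prop :=
  [/\ 0 <= x, ~ setZ S x, forall y, setZ S y -> y <> 0 -> setZ S (x + y)
    & setZ S (x + x)].

Lemma adjoin_special_gap S (x : nat) : numerical_semigroup S ->
  special_gap S x%:Z -> numerical_semigroup (S `|` [set x]) /\ S `<` S `|` [set x].
Proof.
move=> [[S0 SD] Sfin] [_ nSx xS xx]; split; last first.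
  split=> [y|sub]; first by left.
  by apply/nSx/setZP/sub; right.
have xS' y : S y -> y <> 0%N -> S (x + y)%N.
  by move=> Sy y0; apply/setZP; rewrite PoszD; apply: xS; [apply/setZP|case].
split; last by apply: sub_finite_set Sfin; apply: subsetC => y; left.
split; first by left.
move=> y z [Sy|->] [Sz|->].
- by left; exact: SD.
- case: (eqVneq y 0%N) => [->|/eqP y0]; first by right.
  by left; rewrite addnC; exact: xS'.
- case: (eqVneq z 0%N) => [->|/eqP z0]; first by right; rewrite addn0.
  by left; exact: xS'.
- by left; apply/setZP; rewrite PoszD.
Qed.

(** The largest element of [T] outside [S] works: adding to it a nonzero element of [S], or itself,
    gives a larger element of [T]. *)
Lemma special_gap_of_extension S T : numerical_semigroup S -> submonoid T ->
  S `<` T -> exists x : nat, special_gap S x%:Z /\ T x.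
Proof.
move=> [[S0 _] /finite_fsetP [X XE]] [_ TD] [ST nTS].
have gapX x : ~ S x -> x \in X by move=> nSx; rewrite -[is_true _]/([set` X] x) -XE.
have [x0 [Tx0 nSx0]] : exists x, T x /\ ~ S x.
  by apply: contrapT => h; apply: nTS => x Tx; apply: contrapT => nSx; apply: h; exists x.
pose p x := `[<T x /\ ~ S x>].
have exp : exists x, p x by exists x0; apply/asboolP.
have bp x : p x -> (x <= \max_(y <- X) y)%N.
  by move=> /asboolP[_ /gapX xX]; rewrite (big_rem x) //= leq_maxl.
case: (ex_maxnP exp bp) => x /asboolP[Tx nSx] xmax.
have above y : T y -> (x < y)%N -> S y.
  move=> Ty xy; apply: contrapT => nSy.
  by have := xmax y; rewrite leqNgt xy /p asboolT // => /(_ isT).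
have x_gt0 : (0 < x)%N by rewrite lt0n; apply/eqP => x0'; apply: nSx; rewrite x0'.
exists x; split=> //; split=> //; first by move/setZP.
  move=> _ [y Sy <-] y0; rewrite -PoszD; apply/setZP/above; last by lia.
  by apply: TD => //; exact: ST.
by rewrite -PoszD; apply/setZP/above; [exact: TD|lia].
Qed.

(** Distinct special gaps [x] and [y] make [S] the intersection of its extensions by [x] and by [y].
    Conversely, a unique special gap lies in every proper extension, hence in any intersection of
    two. *)
Lemma irreducible_special_gapP S : numerical_semigroup S ->
  (~ exists S1 S2 : set nat,
      [/\ numerical_semigroup S1, numerical_semigroup S2,
          S `<` S1, S `<` S2 & S = S1 `&` S2]) <->
  forall x y, special_gap S x -> special_gap S y -> x = y.
Proof.
move=> nS; split=> [irr x y gx gy|uniq [S1 [S2 [[mS1 _] [mS2 _] SS1 SS2 SE]]]].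
  apply: contrapT => xy; apply: irr.
  have [x0 y0] : 0 <= x /\ 0 <= y by case: gx; case: gy.
  move: x y x0 y0 gx gy xy => [] // x [] // y _ _ gx gy xy.
  have [nSx SSx] := adjoin_special_gap nS gx; have [nSy SSy] := adjoin_special_gap nS gy.
  exists (S `|` [set x]), (S `|` [set y]); split=> //.
  rewrite -setUIr; apply/seteqP; split=> z; first by left.
  by case=> // -[/= zx zy]; case: xy; rewrite -zx -zy.
have [x [gx S1x]] := special_gap_of_extension nS mS1 SS1.
have [y [gy S2y]] := special_gap_of_extension nS mS2 SS2.
case: (gx) => _ nSx _ _; apply: nSx; apply/setZP; rewrite SE; split=> //.
by have [->] := uniq _ _ gx gy.
Qed.

Lemma fundamental_gapsP S x : submonoid S ->
  setZ (fundamental_gaps S) x <->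
  [/\ 0 <= x, ~ setZ S x, setZ S (2 * x) & setZ S (3 * x)].
Proof.
move=> [S0 SD]; split=> [[y [nSy Sj] <-]|[]].
  by split=> //; first (by move/setZP); rewrite -PoszM; apply/setZP/Sj.
case: x => // x _ nSx /setZP S2 /setZP S3; apply/setZP; split=> [/setZP //|j].
(* The cases 2 and 3 are given; [j + 4] follows from [j + 2] by adding [2x]. *)
elim/ltn_ind: j => -[|[|[|[|j]]]] // IH _.
by have := SD _ _ S2 (IH j.+2 _ isT); rewrite -mulnDl !addSn add0n; apply.
Qed.

(* The element of rank [i] in increasing order, counting from [0]. *)
Fixpoint has_rank (A : int -> Prop) (i : nat) (x : int) : Prop :=
  if i is i'.+1 then A x /\ exists y, has_rank A i' y /\
    (y < x /\ forall z, A z -> ~ (y < z /\ z < x))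
  else A x /\ forall z, A z -> x <= z.

Lemma has_rank_uniq A i x y : has_rank A i x -> has_rank A i y -> x = y.
Proof.
elim: i x y => [|i IH] x y /=.
  by move=> [Ax xm] [Ay ym]; apply/eqP; rewrite eq_le xm // ym.
move=> [Ax [x' [rx' [x'x xm]]]] [Ay [y' [ry' [y'y ym]]]].
have E := IH _ _ rx' ry'; rewrite -E in y'y ym.
have [xy|xy|//] := ltgtP x y; first by case: (ym x Ax).
by case: (xm y Ay).
Qed.

Lemma ith_smallest_has_rank i A x : is_ith_smallest i A x ->
  has_rank (setZ A) i.-1 x%:Z.
Proof.
case: i => [[]|i] //= [_]; elim: i x => [|i IH] x Ax cardA.
  split; first exact/setZP.
  move=> _ [z Az <-]; rewrite lez_nat leqNgt; apply/negP => zx.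
  move: cardA; rewrite II0 card_eq0 => /eqP E.
  by suff : set0 z by []; rewrite -E.
have /finite_fsetP [X XE] : finite_set [set y | A y /\ (y < x)%N] by exists i.+1.
have memX y : y \in X <-> A y /\ (y < x)%N by rewrite -[is_true _]/([set` X] y) -XE.
have cardX : #|` X| = i.+1 by apply/card_eq_fsetP; rewrite -XE.
have exX : exists y, y \in X.
  have /fset0Pn [y yX] : X != fset0 by rewrite -cardfs_gt0 cardX.
  by exists y.
have bX y : y \in X -> (y <= x)%N by move/memX => [_ /ltnW].
(* The predecessor of [x] is the largest element of [A] below [x]. *)
case: (ex_maxnP exX bX) => y /[dup] yX /memX [Ay yx] ymax.
split; first exact/setZP.
exists y%:Z; split; last split.
- apply: IH => //; suff -> : [set z | A z /\ (z < y)%N] = [set` (X `\ y)%fset].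
    apply/card_eq_fsetP; have := cardfsD1 y X; rewrite yX cardX; lia.
  apply/seteqP; split=> z /=; rewrite in_fsetD1.
    move=> [Az zy]; have -> : z \in X by apply/memX; split=> //; lia.
    by rewrite andbT; lia.
  by move=> /andP[zy zX]; have [Az zx] := (memX z).1 zX; split=> //; have := ymax z zX; lia.
- by [].
move=> _ [z Az <-] [yz zx].
have zX : z \in X by apply/memX.
by have := ymax z zX; lia.
Qed.

(** * Representations by the generators *)

(** Subtracting one generator at a time keeps both arguments parametric linear: each factorization
    coefficient is a quantified variable, multiplied only by a polynomial in [t]. *)
Fixpoint represents (fs : seq {poly int}) (t : nat) (x l : int) : Prop :=
  if fs is f :: fs' then
    exists z, 0 <= z /\ represents fs' t (x - f.[t%:Z] * z) (l - z)
  else x = 0 /\ l = 0.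

Lemma represents_ppa fs k u v : plin k u -> plin k v ->
  ppa k (fun t e => represents fs t (u t e) (v t e)).
Proof.
elim: fs k u v => [|f fs IH] k u v hu hv /=.
  by apply: ppa_and; apply: ppa_eq => //; exact: plin_const.
have h0 := plin_var (ltn0Sn k); apply: ppa_ex; apply: ppa_and.
  by apply: ppa_le => //; exact: plin_const.
apply: IH; apply: plin_add; try exact: plin_behead; apply: plin_opp => //.
exact: plin_polymul.
Qed.

Lemma representsP (I : eqType) (P : I -> {poly int}) (f : I -> nat -> nat) (s : seq I) t x l :
  (forall i, (f i t)%:Z = (P i).[t%:Z]) -> uniq s ->
  represents (map P s) t x l <-> exists z : I -> nat,
    x = (\sum_(i <- s) z i * f i t)%N /\ l = (\sum_(i <- s) z i)%N.
Proof.
move=> fP; elim: s x l => [|i s IH] x l /=.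
  by move=> _; split=> [[-> ->]|[z]]; [exists (fun=> 0%N)|]; rewrite !big_nil.
move=> /andP[iNs us]; split=> [[a [a0 /(IH _ _ us) [z [xE lE]]]]|[z]].
  case: a a0 xE lE => // a _ xE lE.
  exists (fun j => if j == i then a else z j).
  have E (G : I -> nat -> nat) : (\sum_(j <- s) G j (if j == i then a else z j) =
      \sum_(j <- s) G j (z j))%N.
    apply: eq_big_seq => j js; case: eqVneq => // ji; by rewrite -ji js in iNs.
  rewrite !big_cons eqxx (E (fun j b => b * f j t)%N) (E (fun _ b => b)).
  by rewrite !PoszD -xE -lE PoszM fP; split; ring.
rewrite !big_cons => -[-> ->]; exists (z i)%:Z; split=> //; apply/IH => //.
by exists z; rewrite !PoszD PoszM fP; split; ring.
Qed.

(** The conditions [0 <= F] and [0 <= y] keep out the negative integers, all of which lie outside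
    [setZ S]. *)
Definition frobZ (S : int -> Prop) (F : int) :=
  0 <= F /\ (~ S F /\ forall y, 0 <= y -> ~ S y -> y <= F).

Lemma frobZP S (F : nat) : is_frobenius S F <-> frobZ (setZ S) F%:Z.
Proof.
split=> [[nSF Fm]|[_ [nSF Fm]]].
  split=> //; split; first by move/setZP.
  by case=> // y _ nSy; apply: Fm => /setZP.
split=> [|y nSy]; first by move/setZP.
by apply: (Fm y%:Z) => // /setZP.
Qed.

Lemma frobZ_uniq S F G : frobZ S F -> frobZ S G -> F = G.
Proof.
move=> [F0 [nSF Fm]] [G0 [nSG Gm]]; apply/eqP; rewrite eq_le.
by apply/andP; split; [apply: Gm|apply: Fm].
Qed.

Definition gapsZ (L : int -> Prop) (d : int) := exists l l',
  L l /\ (L l' /\ (l < l' /\ ((forall y, L y -> ~ (l < y /\ y < l')) /\ d = l' - l))).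

Lemma gapsZP L d : setZ (gaps_between L) d <-> gapsZ (setZ L) d.
Proof.
split=> [[_ [l [l' [Ll Ll' ll' cons ->]]] <-]|[_ [_ [[l Ll <-] [[l' Ll' <-] [ll' [cons ->]]]]]]].
  exists l%:Z, l'%:Z; split; first by exists l.
  split; first by exists l'.
  split=> //; split; last by rewrite subzn // ltnW.
  by move=> _ [y Ly <-] [ly yl']; apply: (cons y) => //; apply/andP.
exists (l' - l)%N; last by rewrite subzn // ltnW.
exists l, l'; split=> // y Ly /andP yb; apply: (cons y%:Z) => //; exact/setZP.
Qed.

Definition multZ (S : int -> Prop) (m : int) :=
  (S m /\ 0 < m) /\ forall z, S z -> 0 < z -> m <= z.

Lemma aperyP S y : setZ (apery S) y <->
  setZ S y /\ exists m, multZ (setZ S) m /\ ~ setZ S (y - m).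
Proof.
split=> [[x [Sx [m [[Sm m0] mm] nS]] <-]|[[x Sx <-] [_ [[[[m Sm <-] m0] mm] nS]]]].
  split; first exact/setZP.
  exists m%:Z; split=> //; split; first by split=> //; exact/setZP.
  by move=> _ [z Sz <-] z0; apply: mm.
apply/setZP; split=> //; exists m => //; split=> // z [Sz z0].
by apply: (mm z%:Z) => //; exact/setZP.
Qed.

Lemma pseudo_frobeniusP S x : pseudo_frobenius S x <->
  ~ setZ S x /\ forall y, setZ S y -> y <> 0 -> setZ S (x + y).
Proof.
split=> -[nSx h]; split=> // y Sy y0; last by apply: h; [exact/setZP|case].
by case: Sy y0 => z Sz <- z0; apply: h => // z0'; apply: z0; rewrite z0'.
Qed.

(** * Definability of the semigroup notions *)

Ltac ppa_split := repeat first
  [ apply: ppa_ex | apply: ppa_all | apply: ppa_and | apply: ppa_not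
  | apply: ppa_imp | apply: ppa_le | apply: ppa_lt | apply: ppa_eq
  | match goal with h : definable _ |- _ => apply: h end ].

Ltac plin_solve := repeat first
  [ exact: plin_const | exact: plin_var | exact: plin_poly
  | match goal with h : plin _ _ |- _ =>
      first [ exact h | exact (plin_behead h) | exact (plin_behead (plin_behead h))
            | exact (plin_behead (plin_behead (plin_behead h))) ] end
  | apply: plin_add | apply: plin_opp | apply: plin_scale ].

Lemma definable_frobZ S : definable S -> definable (fun t => frobZ (S t)).
Proof. by move=> hS k u hu; ppa_split; plin_solve. Qed.

Lemma definable_special_gap (S : nat -> set nat) : definable (fun t => setZ (S t)) ->
  definable (fun t => special_gap (S t)).
Proof.
move=> hS k u hu; apply: (@ppa_ext _ (fun t e => 0 <= u t e /\ (~ setZ (S t) (u t e) /\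
  ((forall y, setZ (S t) y -> y <> 0 -> setZ (S t) (u t e + y)) /\
   setZ (S t) (u t e + u t e))))) => [t e|].
  by split=> [[? [? []]]|[]].
by ppa_split; plin_solve.
Qed.

Lemma definable_has_rank (A : nat -> int -> Prop) i : definable A ->
  definable (fun t => has_rank (A t) i).
Proof.
by move=> hA; elim: i => [|i IH] k u hu /=; ppa_split; plin_solve.
Qed.

Lemma ppa_numerical_semigroup (S : nat -> set nat) :
  definable (fun t => setZ (S t)) -> (forall t, submonoid (S t)) ->
  ppa 0 (fun t _ => numerical_semigroup (S t)).
Proof.
move=> hS mS; apply: (@ppa_ext _ (fun t _ => exists b, forall x, b <= x -> setZ (S t) x)) => [t e|].
  by rewrite -finite_complP; split=> [|[]].
by ppa_split; plin_solve.
Qed.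

Lemma ppa_gapsZ (R : nat -> int -> int -> Prop) :
  (forall k u v, plin k u -> plin k v -> ppa k (fun t e => R t (u t e) (v t e))) ->
  forall k u v, plin k u -> plin k v -> ppa k (fun t e => gapsZ (R t (u t e)) (v t e)).
Proof.
by move=> hR k u v hu hv; do ![ppa_split; try apply: hR]; plin_solve.
Qed.

(** Clearing denominators turns the value of a rational polynomial into the unique solution of a
    linear equation over [{poly int}]. *)
Lemma polynomial_fun_rat a : polynomial_fun rat a ->
  exists (D : int) (q : {poly int}), forall (t : nat) (x : int),
    D * x = q.[t%:Z] <-> x = (a t)%:Z.
Proof.
move=> [P aP]; have [q [D D0 PE]] := rat_poly_scale P; exists D, q => t x.
have D0' : D%:~R != 0 :> rat by rewrite intr_eq0.
have E : q.[t%:Z]%:~R = D%:~R * (a t)%:~R :> rat.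
  rewrite -[(a t)%:~R]/((a t)%:R) aP PE hornerZ mulrA divff // mul1r.
  by rewrite -[t%:R]/(t%:Z%:~R) horner_map.
split=> [Dx|->]; last by apply: (@intr_inj rat); rewrite E rmorphM.
by apply: (@intr_inj rat); apply: (mulfI D0'); rewrite -E -Dx rmorphM.
Qed.

(** * Definability of each quantity attached to the generated semigroups *)

Theorem theorem1p2 (k : nat) (f : 'I_k -> nat -> nat)
    (k_ge1 : (1 <= k)%N)
    (f_poly : forall i : 'I_k, polynomial_fun int (f i)) :
  let gens := fun (n : nat) (i : 'I_k) => f i n in
  let S := fun n : nat => generated (gens n) in
  [/\ [/\ eventually_periodic_set [set n | numerical_semigroup (S n)],
          eventually_periodic_set [set n | symmetric_semigroup (S n)]
        & eventually_periodic_set [set n | irreducible_semigroup (S n)]],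
      [/\ eqp_card (fun n => ~` S n),
          eqp_where_defined (fun n F => is_frobenius (S n) F),
          eqp_card (fun n => pseudo_frobenius (S n)),
          eqp_card (fun n => fundamental_gaps (S n))
        & eqp_card (fun n => delta_set (gens n)) /\
          forall i : nat, (1 <= i)%N ->
            eqp_where_defined (fun n x => is_ith_smallest i (apery (S n)) x)]
    & forall a : nat -> nat, polynomial_fun rat a ->
        eqp_card (fun n => length_set (gens n) (a n)) /\
        eqp_card (fun n => delta_elt (gens n) (a n))].
Proof.
move=> gens S; have [P fP] := choice f_poly.
pose R := represents [seq P i | i <- enum 'I_k].
have hR : forall k u v, plin k u -> plin k v -> ppa k (fun t e => R t (u t e) (v t e)).
  by move=> *; exact: represents_ppa.
have RE t (x l : int) : R t x l <-> exists x' l' : nat,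
    [/\ x = x', l = l' & length_set (gens t) x' l'].
  rewrite /R (@representsP _ _ f) ?enum_uniq //; last by move=> i; rewrite -natz fP natz.
  under eq_exists do rewrite !big_enum.
  by split=> [[z [-> ->]]|[_ [_ [-> -> [z [-> ->]]]]]]; [|exists z]; do 2!eexists; split=> //; exists z.
have RZ t (x : nat) : R t x%:Z = setZ (length_set (gens t) x).
  apply/funext => l; apply/propext; rewrite RE.
  by split=> [[_ [l' [[<-] -> Ll]]]|[l' Ll <-]]; [exists l'|exists x, l'].
have SR t x : setZ (S t) x <-> exists l, R t x l.
  split=> [[x' [z xE] <-]|[l /RE [x' [l' [-> _ [z [xE _]]]]]]].
    by exists (\sum_(i < k) z i)%N; apply/RE; do 2!eexists; split=> //; exists z.
  by exists x' => //; exists z.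
have hS : definable (fun t => setZ (S t)).
  move=> n u hu; apply: (@ppa_ext _ (fun t e => exists l, R t (u t e) l)) => [t e|].
    by rewrite SR.
  by apply: ppa_ex; apply: hR; plin_solve.
have mS t : submonoid (S t).
  split; first by exists (fun=> 0%N); rewrite big1.
  move=> _ _ [z ->] [w ->]; exists (fun i => z i + w i)%N.
  by rewrite -big_split; apply: eq_bigr => i _; rewrite mulnDl.
have hnum := ppa_numerical_semigroup hS mS.
have hgaps := ppa_gapsZ hR.
split; [split|split|].
- exact: (ppa_periodic hnum).
- apply: (@ppa_periodic (fun t _ => symmetric_semigroup (S t))).
  apply: (@ppa_ext _ (fun t _ => numerical_semigroup (S t) /\
    forall F, frobZ (setZ (S t)) F -> forall z, ~ setZ (S t) z -> setZ (S t) (F - z))).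
    move=> t _; split=> -[nS h]; split=> // F; first by move/frobZP; exact: h.
    by case: F => [F /frobZP|F [] //]; exact: h.
  have hF := definable_frobZ hS.
  by apply: ppa_and => //; ppa_split; plin_solve.
- apply: (@ppa_periodic (fun t _ => irreducible_semigroup (S t))).
  apply: (@ppa_ext _ (fun t _ => numerical_semigroup (S t) /\
    forall x y, special_gap (S t) x -> special_gap (S t) y -> x = y)).
    by move=> t _; split=> -[nS h]; split=> //; apply/(irreducible_special_gapP nS).
  have hg := definable_special_gap hS.
  by apply: ppa_and => //; ppa_split; plin_solve.
- apply: definable_eqp_card => n u hu.
  apply: (@ppa_ext _ (fun t e => 0 <= u t e /\ ~ setZ (S t) (u t e))) => [t e|].
    split=> [[]|[x nSx <-]]; last by split=> // /setZP.
    by case: (u t e) => // x _ nSx; exists x => // /setZP.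
  by ppa_split; plin_solve.
- apply: (definable_eqp_where_defined (R := fun t => frobZ (setZ (S t)))).
  + by move=> t x /frobZP.
  + by move=> t x y; exact: frobZ_uniq.
  + exact: definable_frobZ.
- apply: definable_eqp_cardZ => n u hu.
  apply: (@ppa_ext _ (fun t e => ~ setZ (S t) (u t e) /\
     forall y, setZ (S t) y -> y <> 0 -> setZ (S t) (u t e + y))) => [t e|].
    by rewrite -pseudo_frobeniusP.
  by ppa_split; plin_solve.
- apply: definable_eqp_card => n u hu.
  apply: (@ppa_ext _ (fun t e => 0 <= u t e /\ (~ setZ (S t) (u t e) /\
     (setZ (S t) (2 * u t e) /\ setZ (S t) (3 * u t e))))) => [t e|].
    by rewrite (fundamental_gapsP _ (mS t)); split=> [[? [? []]]|[]].
  by ppa_split; plin_solve.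
- split=> [|i _].
    apply: definable_eqp_card => n u hu.
    apply: (@ppa_ext _ (fun t e => exists x, gapsZ (R t x) (u t e))) => [t e|].
      split=> [[x gx]|[d [x Sx /= dx] <-]].
        (* A gap between lengths presupposes a representation, so the integer [x] is a natural
           number in [S t]. *)
        have [l [l' [/RE [x' [l1 [xE _ [z [zE _]]]]] _]]] := gx.
        move: gx; rewrite xE RZ => /gapsZP [d dg <-]; exists d => //.
        by exists x' => //; exists z.
      by exists x%:Z; rewrite RZ; apply/gapsZP; exists d.
    by apply: ppa_ex; apply: hgaps; plin_solve.
  have hA : definable (fun t => setZ (apery (S t))).
    move=> n u hu; apply: (@ppa_ext _ (fun t e => setZ (S t) (u t e) /\
       exists m, multZ (setZ (S t)) m /\ ~ setZ (S t) (u t e - m))) => [t e|].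
      by rewrite aperyP.
    by ppa_split; plin_solve.
  apply: (definable_eqp_where_defined (R := fun t => has_rank (setZ (apery (S t))) i.-1)).
  + by move=> t x; exact: ith_smallest_has_rank.
  + by move=> t x y; exact: has_rank_uniq.
  + exact: definable_has_rank.
- move=> a /polynomial_fun_rat [D [q aE]]; split; apply: definable_eqp_card => n u hu.
    (* [a t] need not be an integer polynomial, so it enters as a quantified [x] tied to [t] by [D *
       x = q.[t]]. *)
    apply: (@ppa_ext _ (fun t e => exists x, D * x = q.[t%:Z] /\ R t x (u t e))) => [t e|].
      by rewrite -RZ; split=> [[x [/aE ->]]|Rx] //; exists (a t)%:Z; split=> //; exact/aE.
    by apply: ppa_ex; apply: ppa_and; [apply: ppa_eq|apply: hR]; plin_solve.
  apply: (@ppa_ext _ (fun t e => exists x, D * x = q.[t%:Z] /\ gapsZ (R t x) (u t e))) => [t e|].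
    rewrite /delta_elt gapsZP -RZ.
    by split=> [[x [/aE ->]]|Rx] //; exists (a t)%:Z; split=> //; exact/aE.
  by apply: ppa_ex; apply: ppa_and; [apply: ppa_eq|apply: hgaps]; plin_solve.
Qed.
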